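(* Let $k$ be an algebraically closed field, let $Q$ be the double-Kronecker quiver with vertices $1,2,3$, arrows $\alpha_1,\alpha_2:1\to 2$ and $\beta_1,\beta_2:2\to 3$, let $I=\langle \alpha_1\beta_1,\alpha_2\beta_2\rangle$ and $A=kQ/I$. Put $a=\alpha_1^{-1}\alpha_2$ and $b=\beta_1\beta_2^{-1}$. For an infinite string $w$ over $A$, the following hold. (1) If $s(w)=1$, then $M(w)$ is a brick if and only if either $w=\alpha_2 b w'$ with $w'$ a characteristic Sturmian word in $\operatorname{Str}(a,b)$, or else $w=\alpha_1 b^{-1}w'$ with $w'$ a characteristic Sturmian word in $\operatorname{Str}(a^{-1},b^{-1})$. (2) If $s(w)=2$, then $M(w)$ is a brick if and only if $w$ is a characteristic Sturmian word in $\operatorname{Str}(a,b)$ or a characteristic Sturmian word in $\operatorname{Str}(a^{-1},b^{-1})$. (3) If $s(w)=3$, then $M(w)$ is a brick if and only if either $w=\beta_2^{-1}a w'$ with $w'$ a characteristic Sturmian word in $\operatorname{Str}(a,b)$, or else $w=\beta_1^{-1}a^{-1}w'$ with $w'$ a characteristic Sturmian word in $\operatorname{Str}(a^{-1},b^{-1})$. (4) If $w$ is left-infinite, then $M(w)$ is a brick if and only if $M(w^{-1})$ is a brick. (5) If $w$ is double-infinite, then $M(w)$ is a brick if and only if $w$ or $w^{-1}$ is a Sturmian word in $\operatorname{Str}(a,b)$.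
   Context: Paths are composed from left to right ($\alpha\beta$ means first $\alpha$, then $\beta$). Each arrow $\gamma$ has a formal inverse $\gamma^{-1}$ with $s(\gamma^{-1})=t(\gamma)$, $t(\gamma^{-1})=s(\gamma)$. Strings. A finite string over $A=kQ/I$ is a trivial string $e_i$ at a vertex $i$, or a word $w=\gamma_1^{\epsilon_1}\cdots\gamma_d^{\epsilon_d}$ ($\gamma_i$ arrows, $\epsilon_i=\pm1$) with $s(\gamma_{i+1}^{\epsilon_{i+1}})=t(\gamma_i^{\epsilon_i})$, $\gamma_{i+1}^{\epsilon_{i+1}}\neq\gamma_i^{-\epsilon_i}$, such that neither $w$ nor $w^{-1}=\gamma_d^{-\epsilon_d}\cdots\gamma_1^{-\epsilon_1}$ contains a subpath in $I$. Right-infinite strings $\gamma_1^{\epsilon_1}\gamma_2^{\epsilon_2}\cdots$, left-infinite strings and double-infinite strings are the corresponding infinite words all of whose finite subwords (of consecutive letters) are strings; ''infinite'' means any of these three types. A right-infinite string starts at $s(w)=s(\gamma_1^{\epsilon_1})$; left-infinite and double-infinite strings have no start. The inverse $w^{-1}$ reverses the order of letters and inverts each of them. String modules. $A$-modules (right modules) are identified with representations of $(Q,I)$. For a string $w$ (finite or infinite) visiting the multiset of vertices $\{x_i\}_i$, $x_i$ and $x_{i+1}$ being the start and the end of its $i$-th letter $\gamma_i^{\epsilon_i}$, the string module $M(w)$ has basis $\{x_i\}_i$, where $x_i$ is placed at the vertex visited; $\gamma_i$ maps $x_i$ to $x_{i+1}$ if $\epsilon_i=1$, and maps $x_{i+1}$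 to $x_i$ if $\epsilon_i=-1$; all other actions of arrows on basis elements are zero. A module is a brick if its endomorphism algebra is a division algebra. $\operatorname{Str}(a,b)$ is the set of all strings over $A$ (finite, including the trivial string at $2$, or infinite) that can be written as words in $a$ and $b$ (with no $a^{-1}$, $b^{-1}$); its elements are identified with binary words in $a,b$. Likewise $\operatorname{Str}(a^{-1},b^{-1})$ consists of words in $a^{-1},b^{-1}$, and notions for binary words are applied to it with $a^{-1},b^{-1}$ in the roles of $a,b$. Binary words. An infinite binary word $w$ is periodic if $w=\sigma\sigma\cdots$, $w=\cdots\sigma\sigma$ or $w=\cdots\sigma\sigma\sigma\cdots$ for a finite word $\sigma$; eventually right-periodic (resp. left-periodic) if $w=w_1w_2$ with $w_2$ (resp. $w_1$) infinite periodic; aperiodic if none of these hold. A word is balanced if for every $n\geq1$ the numbers of $b$'s in any two of its subwords (blocks of consecutive letters) of length $n$ differ by at most one. An infinite word is Sturmian if it is balanced and aperiodic. The characteristic word of slope $m>0$ is the right-infinite word obtained by following the line $y=mx$ over $x\in(0,\infty)$ in order of increasing $x$, writing $b$ for each point with integer $x$-coordinate and $a$ for each point with integer $y$-coordinate ($ba$ if both are integers). A characteristic Sturmian word is a characteristic word of irrational slope $m>0$. *)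

(* Defs.v *)
From HB Require Import structures.
From mathcomp Require Import all_boot all_order all_algebra.
From mathcomp Require Import freeg reals zify.

Set Implicit Arguments.
Unset Strict Implicit.
Unset Printing Implicit Defensive.

Import Order.TTheory GRing.Theory Num.Theory.
Local Open Scope ring_scope.

Variant vertex := v1 | v2 | v3.
Variant arrow := alpha1 | alpha2 | beta1 | beta2.

Definition nat_of_vertex (i : vertex) : nat :=
  match i with v1 => 0 | v2 => 1 | v3 => 2 end.
Definition vertex_of_nat (n : nat) : vertex :=
  match n with 0 => v1 | 1 => v2 | _ => v3 end.
Lemma nat_of_vertexK : cancel nat_of_vertex vertex_of_nat.
Proof. by case. Qed.
HB.instance Definition _ := Countable.copy vertex (can_type nat_of_vertexK).

Definition nat_of_arrow (g : arrow) : nat :=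
  match g with alpha1 => 0 | alpha2 => 1 | beta1 => 2 | beta2 => 3 end.
Definition arrow_of_nat (n : nat) : arrow :=
  match n with 0 => alpha1 | 1 => alpha2 | 2 => beta1 | _ => beta2 end.
Lemma nat_of_arrowK : cancel nat_of_arrow arrow_of_nat.
Proof. by case. Qed.
HB.instance Definition _ := Countable.copy arrow (can_type nat_of_arrowK).

Definition src (g : arrow) : vertex :=
  match g with alpha1 | alpha2 => v1 | beta1 | beta2 => v2 end.
Definition tgt (g : arrow) : vertex :=
  match g with alpha1 | alpha2 => v2 | beta1 | beta2 => v3 end.

(** Paths are composed from left to right.  As the ideal [I] is generated by
    paths, a path lies in [I] iff one of the generators is a subpath of it. *)
Definition is_path (p : seq arrow) : bool :=
  sorted (fun g h => tgt g == src h) p.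
Definition path_in_I (p : seq arrow) : bool :=
  is_path p && (infix [:: alpha1; beta1] p || infix [:: alpha2; beta2] p).

(** [(g, true)] is the arrow [g], [(g, false)] is its formal inverse. *)
Definition letter := (arrow * bool)%type.
Definition lsrc (l : letter) : vertex := if l.2 then src l.1 else tgt l.1.
Definition ltgt (l : letter) : vertex := if l.2 then tgt l.1 else src l.1.
Definition linv (l : letter) : letter := (l.1, ~~ l.2).
Definition winv (s : seq letter) : seq letter := rev [seq linv l | l <- s].
Definition path_word (p : seq arrow) : seq letter := [seq (g, true) | g <- p].

(** [RightInf f] is [f 0 f 1 f 2 ...]; [LeftInf f] is [... f 2 f 1 f 0];
    [DoubleInf f] is [... f (-1) f 0 f 1 ...]. *)
Variant infword (T : Type) :=
  | RightInf of nat -> T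
  | LeftInf of nat -> T
  | DoubleInf of int -> T.

(** Equality of infinite words; the indexing of a double-infinite word is only
    meaningful up to translation. *)
Definition same_word (T : Type) (w w' : infword T) : Prop :=
  match w, w' with
  | RightInf f, RightInf g => f =1 g
  | LeftInf f, LeftInf g => f =1 g
  | DoubleInf f, DoubleInf g => exists c : int, forall i, f i = g (i + c)
  | _, _ => False
  end.

Definition prepend (T : Type) (s : seq T) (f : nat -> T) : nat -> T :=
  fun i => nth (f (i - size s)%N) s i.

(** [factor w n s]: [s] is a block of [n] consecutive letters of [w]. *)
Definition factor (T : Type) (w : infword T) (n : nat) (s : seq T) : Prop :=
  match w with
  | RightInf f => exists i : nat, s = mkseq (fun j => f (i + j)%N) n
  | LeftInf f => exists i : nat, s = rev (mkseq (fun j => f (i + j)%N) n)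
  | DoubleInf f => exists i : int, s = mkseq (fun j => f (i + j%:Z)) n
  end.

Definition finite_string (s : seq letter) : Prop :=
  [/\ sorted (fun l m => ltgt l == lsrc m) s,
      sorted (fun l m => m != linv l) s
    & forall p : seq arrow, path_in_I p ->
        ~~ infix (path_word p) s /\ ~~ infix (path_word p) (winv s)].

Definition is_string (w : infword letter) : Prop :=
  forall n s, factor w n s -> finite_string s.

Definition starts_at (w : infword letter) (i : vertex) : Prop :=
  if w is RightInf f then lsrc (f 0%N) = i else False.

Definition left_infinite (w : infword letter) : bool :=
  if w is LeftInf _ then true else false.

Definition double_infinite (w : infword letter) : bool :=
  if w is DoubleInf _ then true else false.

Definition word_inv (w : infword letter) : infword letter :=
  match w with
  | RightInf f => LeftInf (fun i => linv (f i))
  | LeftInf f => RightInf (fun i => linv (f i))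
  | DoubleInf f => DoubleInf (fun i => linv (f (- i)))
  end.

Lemma linvK : involutive linv.
Proof. by case=> g []. Qed.

Lemma ltgt_inv l : ltgt (linv l) = lsrc l.
Proof. by case: l => g []. Qed.

Lemma lsrc_inv l : lsrc (linv l) = ltgt l.
Proof. by case: l => g []. Qed.

Lemma winvK : involutive winv.
Proof.
by move=> s; rewrite /winv map_rev revK -map_comp map_id_in // => l _; apply: linvK.
Qed.

Lemma finite_string_winv s : finite_string s -> finite_string (winv s).
Proof.
case=> cs rs Is; split.
- rewrite /winv rev_sorted sorted_map; apply: sub_sorted cs => l m.
  by rewrite /= ltgt_inv lsrc_inv eq_sym.
- rewrite /winv rev_sorted sorted_map; apply: sub_sorted rs => l m /=.
  by rewrite (can_eq linvK) eq_sym; apply: contraNN => /eqP->; rewrite linvK.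
- by move=> p /Is[? ?]; rewrite winvK.
Qed.

Lemma factor_word_inv w n s : factor (word_inv w) n s -> factor w n (winv s).
Proof.
case: w => f /= [i ->].
- exists i; rewrite /winv map_rev revK -map_comp.
  by apply: eq_map => j /=; rewrite linvK.
- exists i; rewrite /winv -map_comp; congr rev.
  by apply: eq_map => j /=; rewrite linvK.
- exists (- i - n%:Z + 1); apply: (@eq_from_nth _ (f 0)).
    by rewrite size_rev size_map !size_mkseq.
  move=> j; rewrite size_rev size_map size_mkseq => jn.
  rewrite nth_rev size_map size_mkseq // nth_mkseq //.
  have jn' : (n - j.+1 < n)%N by rewrite ltn_subrL (leq_ltn_trans _ jn).
  rewrite (nth_map (f 0)) ?size_mkseq // nth_mkseq // linvK; congr f.
  by rewrite -subzn // -addn1 PoszD !opprD !opprK !addrA; lia.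
Qed.

Lemma is_string_word_inv w : is_string w -> is_string (word_inv w).
Proof.
move=> ws n s /factor_word_inv /ws.
by move/finite_string_winv; rewrite winvK.
Qed.

Record representation (k : fieldType) := Representation {
  rspace : vertex -> lmodType k;
  raction : forall g : arrow, {linear rspace (src g) -> rspace (tgt g)};
  relation1 : forall x : rspace v1, raction beta1 (raction alpha1 x) = 0;
  relation2 : forall x : rspace v1, raction beta2 (raction alpha2 x) = 0
}.

Definition is_endomorphism (k : fieldType) (M : representation k)
    (phi : forall i : vertex, {linear rspace M i -> rspace M i}) : Prop :=
  forall (g : arrow) (x : rspace M (src g)),
    phi (tgt g) (raction M g x) = raction M g (phi (src g) x).

(** The endomorphism algebra is a division algebra: the identity is nonzero and
    every nonzero endomorphism is invertible in the endomorphism algebra. *)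
Definition brick (k : fieldType) (M : representation k) : Prop :=
  (exists (i : vertex) (x : rspace M i), x != 0) /\
  (forall phi, is_endomorphism phi ->
    (exists (i : vertex) (x : rspace M i), phi i x != 0) ->
    exists psi : forall i : vertex, {linear rspace M i -> rspace M i},
      is_endomorphism psi /\
      forall i, cancel (phi i) (psi i) /\ cancel (psi i) (phi i)).

(** Positions between letters.  The letter [f i] goes from position [i] to
    position [i + 1] in [RightInf f] and [DoubleInf f], and from position
    [i + 1] to position [i] in [LeftInf f]. *)
Definition pos (w : infword letter) : choiceType :=
  match w with DoubleInf _ => int | _ => nat end.

Definition vertex_at (w : infword letter) : pos w -> vertex :=
  match w return pos w -> vertex with
  | RightInf f => fun p => lsrc (f p)
  | LeftInf f => fun p => ltgt (f p)
  | DoubleInf f => fun p => lsrc (f p)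
  end.

(** [step w g p] is the position [q], if any, such that [g] maps the basis
    element at [p] to the basis element at [q].  In a string at most one of the
    two branches of each case applies, because strings are reduced. *)
Definition step (w : infword letter) (g : arrow) : pos w -> option (pos w) :=
  match w return pos w -> option (pos w) with
  | RightInf f => fun p : nat =>
      if f p == (g, true) then Some p.+1
      else if p is q.+1 then if f q == (g, false) then Some q else None
      else None
  | LeftInf f => fun p : nat =>
      if f p == (g, false) then Some p.+1
      else if p is q.+1 then if f q == (g, true) then Some q else None
      else None
  | DoubleInf f => fun p : int =>
      if f p == (g, true) then Some (p + 1)
      else if f (p - 1) == (g, false) then Some (p - 1)
      else None
  end.

Lemma string_consecutive w l m : is_string w -> factor w 2 [:: l; m] ->
  [/\ ltgt l = lsrc m, m <> linv l
    & forall g h, path_in_I [:: g; h] ->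
        ~ (l = (g, true) /\ m = (h, true)) /\ ~ (l = (h, false) /\ m = (g, false))].
Proof.
move=> ws /ws[/=]; rewrite !andbT => /eqP-> /eqP lm Iw; split=> // g h /Iw[nI nI'].
by split=> -[El Em]; [move: nI | move: nI']; rewrite El Em /winv /= !eqxx.
Qed.

Lemma factor2_right T (f : nat -> T) i : factor (RightInf f) 2 [:: f i; f i.+1].
Proof. by exists i; rewrite /mkseq /= addn0 addn1. Qed.

Lemma factor2_left T (f : nat -> T) i : factor (LeftInf f) 2 [:: f i.+1; f i].
Proof. by exists i; rewrite /mkseq /= addn0 addn1. Qed.

Lemma factor2_double T (f : int -> T) i : factor (DoubleInf f) 2 [:: f i; f (i + 1)].
Proof. by exists i; rewrite /mkseq /= addr0. Qed.

Lemma vertex_at_step w g p q : is_string w -> @step w g p = Some q ->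
  vertex_at q = tgt g.
Proof.
case: w p q => f /= p q ws.
- case: eqP => [fp [<-]|_].
    by case: (string_consecutive ws (factor2_right f p)) => <-; rewrite fp.
  by case: p => // p; case: eqP => // fp [<-]; rewrite fp.
- case: eqP => [fp [<-]|_].
    by case: (string_consecutive ws (factor2_left f p)) => ->; rewrite fp.
  by case: p => // p; case: eqP => // fp [<-]; rewrite fp.
- case: eqP => [fp [<-]|_].
    by case: (string_consecutive ws (factor2_double f p)) => <-; rewrite fp.
  by case: eqP => // fp [<-]; rewrite fp.
Qed.

Lemma step_step w g h p q : is_string w -> path_in_I [:: g; h] ->
  @step w g p = Some q -> @step w h q = None.
Proof.
move=> ws Igh.
have gh : h <> g by move: Igh; case: (g); case: (h).
case: w p q ws => f /= p q ws.
- case: eqP => [fp [<-]|_].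
    have [_ _ /(_ _ _ Igh)[I1 _]] := string_consecutive ws (factor2_right f p).
    case: eqP => [fp1|_]; first by case: I1.
    by rewrite fp; case: eqP => // -[].
  case: p => // p; case: eqP => // fp [<-]; rewrite fp.
  case: eqP => // _; case: p fp => // p fp; case: eqP => // fp1.
  have [_ _ /(_ _ _ Igh)[_ []]] := string_consecutive ws (factor2_right f p).
  by [].
- case: eqP => [fp [<-]|_].
    have [_ _ /(_ _ _ Igh)[_ I1]] := string_consecutive ws (factor2_left f p).
    case: eqP => [fp1|_]; first by case: I1.
    by rewrite fp; case: eqP => // -[].
  case: p => // p; case: eqP => // fp [<-]; rewrite fp.
  case: eqP => // _; case: p fp => // p fp; case: eqP => // fp1.
  have [_ _ /(_ _ _ Igh)[[]]] := string_consecutive ws (factor2_left f p).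
  by [].
- case: eqP => [fp [<-]|_].
    have [_ _ /(_ _ _ Igh)[I1 _]] := string_consecutive ws (factor2_double f p).
    case: eqP => [fp1|_]; first by case: I1.
    by rewrite addrK fp; case: eqP => // -[].
  case: eqP => // fp [<-]; rewrite fp.
  case: eqP => // _; case: eqP => // fp1.
  have := string_consecutive ws (factor2_double f (p - 1 - 1)).
  rewrite subrK => -[_ _ /(_ _ _ Igh)[_ []]].
  by [].
Qed.

Section FreeLift.
Variables (k : fieldType) (K : choiceType) (M : lmodType k) (f : K -> M).

HB.instance Definition _ := GRing.isZmodMorphism.Build {freeg K / k} M
  (fglift f) (lift_is_additive f).

Lemma fglift_scalable : scalable (fglift f).
Proof.
move=> c D; rewrite -{1}[D]freeg_sumE scaler_sumr !raddf_sum /=.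
rewrite -[D in RHS]freeg_sumE raddf_sum scaler_sumr; apply: eq_bigr => p _ /=.
have -> : c *: << coeff p D *g p >> = << c * coeff p D *g p >> :> {freeg K / k}.
  by apply/eqP/freeg_eqP => q; rewrite coeffZ !coeffU mulrA.
by rewrite !liftU scalerA.
Qed.

HB.instance Definition _ := GRing.isScalable.Build k {freeg K / k} M *:%R
  (fglift f) fglift_scalable.

Lemma fglift_eq0 (N : lmodType k) (h : {linear M -> N}) :
  (forall p, h (f p) = 0) -> forall D, h (fglift f D) = 0.
Proof.
move=> hf D; rewrite -[D]freeg_sumE !raddf_sum big1 // => p _ /=.
by rewrite liftU linearZ /= hf scaler0.
Qed.

End FreeLift.

Section StringModule.
Variables (k : fieldType) (w : infword letter) (ws : is_string w).

(** The space at [i] is free on the positions of [w] that visit [i]. *)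
Definition basis_at (i : vertex) : choiceType :=
  {p : pos w | vertex_at p == i}.

Definition string_space (i : vertex) : lmodType k := {freeg (basis_at i) / k}.

(** By [vertex_at_step], [insub] never fails on the position given by [step]. *)
Definition basis_image (g : arrow) (p : basis_at (src g)) :
    string_space (tgt g) :=
  if obind insub (step g (val p)) is Some q then << q >> else 0.

Definition string_action (g : arrow) :
    {linear string_space (src g) -> string_space (tgt g)} :=
  fglift (@basis_image g).

Lemma string_relation1 (x : string_space v1) :
  string_action beta1 (string_action alpha1 x) = 0.
Proof.
apply: fglift_eq0 => p; rewrite /basis_image.
case E: (step alpha1 (val p)) => [q|] /=; last exact: raddf0.
case: insubP => [q' _ qE|_]; last exact: raddf0.
by rewrite liftU /basis_image qE (step_step ws _ E) //= scaler0.
Qed.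

Lemma string_relation2 (x : string_space v1) :
  string_action beta2 (string_action alpha2 x) = 0.
Proof.
apply: fglift_eq0 => p; rewrite /basis_image.
case E: (step alpha2 (val p)) => [q|] /=; last exact: raddf0.
case: insubP => [q' _ qE|_]; last exact: raddf0.
by rewrite liftU /basis_image qE (step_step ws _ E) //= scaler0.
Qed.

Definition string_module : representation k :=
  Representation string_relation1 string_relation2.

End StringModule.

(** In binary words, [false] stands for the letter a, [true] for the letter b *)

Definition periodic (u : infword bool) : Prop :=
  match u with
  | RightInf f => exists s : seq bool, (0 < size s)%N /\
      forall i : nat, f i = nth false s (i %% size s)
  | LeftInf f => exists s : seq bool, (0 < size s)%N /\
      forall i : nat, f i = nth false (rev s) (i %% size s)
  | DoubleInf f => exists s : seq bool, (0 < size s)%N /\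
      forall i : int, f i = nth false s `|(i %% size s)%Z|%N
  end.

(** A left-infinite word has no right-infinite tail, and a right-infinite word
    no left-infinite head. *)
Definition eventually_right_periodic (u : infword bool) : Prop :=
  match u with
  | RightInf f => exists n : nat, periodic (RightInf (fun i => f (n + i)%N))
  | LeftInf _ => False
  | DoubleInf f => exists n : int, periodic (RightInf (fun i => f (n + i%:Z)))
  end.

Definition eventually_left_periodic (u : infword bool) : Prop :=
  match u with
  | RightInf _ => False
  | LeftInf f => exists n : nat, periodic (LeftInf (fun i => f (n + i)%N))
  | DoubleInf f => exists n : int, periodic (LeftInf (fun i => f (n - i%:Z)))
  end.

Definition aperiodic (u : infword bool) : Prop :=
  [/\ ~ periodic u, ~ eventually_right_periodic u & ~ eventually_left_periodic u].

Definition balanced (u : infword bool) : Prop :=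
  forall n s t, (0 < n)%N -> factor u n s -> factor u n t ->
    (count id s <= (count id t).+1)%N.

Definition sturmian (u : infword bool) : Prop := balanced u /\ aperiodic u.

Section Characteristic.
Variable R : realType.

(** The points of the line [y = m x], [x > 0], having an integer coordinate:
    [(true, n)] is the point with [x = n + 1] and [(false, n)] is the point with
    [y = n + 1]; a point with both coordinates integral is counted twice. *)
Definition abscissa (m : R) (e : bool * nat) : R :=
  if e.1 then e.2.+1%:R else e.2.+1%:R / m.

Definition before (m : R) (e e' : bool * nat) : bool :=
  (abscissa m e < abscissa m e')
  || [&& abscissa m e == abscissa m e', e.1 & ~~ e'.1].

Definition characteristic (m : R) (u : nat -> bool) : Prop :=
  exists e : nat -> bool * nat,
    [/\ forall x, exists i, e i = x,
        forall i j, (i < j)%N -> before m (e i) (e j)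
      & forall i, u i = (e i).1].

Definition characteristic_sturmian (u : nat -> bool) : Prop :=
  exists m : R, [/\ 0 < m, irrational m & characteristic m u].

End Characteristic.

(** The word obtained from [u] by substituting [x] for [false] and [y] for
    [true], where [x] and [y] are blocks of exactly two letters. *)
Definition spell (x y : seq letter) (u : infword bool) : infword letter :=
  let blk c i := nth (alpha1, true) (if c then y else x) i in
  match u with
  | RightInf f => RightInf (fun i => blk (f (i %/ 2)%N) (i %% 2)%N)
  | LeftInf f => LeftInf (fun i => blk (f (i %/ 2)%N) (1 - i %% 2)%N)
  | DoubleInf f => DoubleInf (fun i => blk (f (i %/ 2)%Z) `|(i %% 2)%Z|%N)
  end.

(** [Str x y w u]: [w] is the element of Str(x, y) identified with [u]. *)
Definition Str (x y : seq letter) (w : infword letter) (u : infword bool) : Prop :=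
  is_string w /\ same_word w (spell x y u).

Definition sturmian_in (x y : seq letter) (w : infword letter) : Prop :=
  exists u, Str x y w u /\ sturmian u.

Definition characteristic_sturmian_in (R : realType) (x y : seq letter)
    (w : infword letter) : Prop :=
  exists u, Str x y w (RightInf u) /\ characteristic_sturmian R u.

Definition a : seq letter := [:: (alpha1, false); (alpha2, true)].
Definition b : seq letter := [:: (beta1, true); (beta2, false)].

(* Main.v *)
(** A matrix entry [c p q] of an endomorphism of a string module propagates along
    the diagonal through [(p, q)] as long as the letters next to [p] and [q]
    agree, is forced to vanish at a mismatch of one kind and is left free by a
    mismatch of the other kind.  Hence a nonscalar endomorphism exists iff for
    some [p <> q] the word read from [p] is lexicographically at least the word
    read from [q], both to the right and to the left; then the maximal agreeing
    stretch around [(p, q)] gives a partial shift of the basis which, or whose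
    difference with the identity, is a noninvertible endomorphism.  So a brick
    is a word without such pairs.  An infinite agreement is eventual
    periodicity.  A finite agreement between two mismatches is a pair of
    factors [b t b], [a t a], and such a pair exists iff the word is unbalanced.
    At the start of a right-infinite word [u] the condition says that [a u] and
    [b u] are balanced, which makes the numbers of b's in the prefixes of [u]
    additive up to one; their slope is a supremum, irrational by aperiodicity,
    and [u] is the characteristic word of the corresponding line. *)

Require Import Defs.
From HB Require Import structures.
From mathcomp Require Import all_boot all_order all_algebra.
From mathcomp Require Import freeg boolp classical_sets reals zify ring lra.

Set Implicit Arguments.
Unset Strict Implicit.
Unset Printing Implicit Defensive.

Import Order.TTheory GRing.Theory Num.Theory.
Local Open Scope ring_scope.

(** The values 0 to 4 are ordered so that the start of a word is one more letter in the comparison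
    on the left. Whenever the target value exceeds the source value, some arrow kills the source
    vector but not the target vector, or has the source vector but not the target vector in its
    image, at once or after one step along a common arrow; the entry must vanish. Half a block a is
    thus below everything and half a block b above everything, so a brick starting at vertex 1 goes
    on with b and one starting at vertex 3 with a.

    The proof runs in a circle: a brick admits no nontrivial graph map, hence [v] is incomparable,
    hence every matrix with the entrywise conditions is scalar, and this gives a brick. Only single
    entries are used, so infinite words cause no trouble with supports, and a word can be exchanged
    with its inverse along a bijection of positions. This disposes of left-infinite words, which get
    no encoding of their own. *)

Lemma freeg_lin_ext (k : fieldType) (K : choiceType) (M : lmodType k)
    (f g : {linear {freeg K / k} -> M}) :
  (forall x, f << x >> = g << x >>) -> f =1 g.
Proof.
move=> fg D; rewrite -[D]freeg_sumE !raddf_sum; apply: eq_bigr => x _ /=.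
have -> : << coeff x D *g x >> = coeff x D *: << x >> :> {freeg K / k}.
  by apply/eqP/freeg_eqP => y; rewrite coeffZ !coeffU mul1r.
by rewrite !linearZ /= fg.
Qed.

Lemma fglift1 (k : fieldType) (K : choiceType) (M : lmodType k) (f : K -> M) x :
  fglift f << x >> = f x.
Proof. by rewrite liftU scale1r. Qed.

(** Necessary conditions on the matrix of an endomorphism of a string module in
    the basis of positions, and the partial maps of positions which extend to
    endomorphisms by sending the positions outside their domain to [0]. *)
Section EndomorphismConditions.
Variables (P : eqType) (vtx : P -> vertex) (st : arrow -> P -> option P).

(** [c p q] is the coefficient of [q] in the image of [p]. The first three clauses read one
    coordinate of the commutation with [g]: for [q'] in the image of [g], for [q'] outside it, and
    for [p] killed by [g]. *)
Definition endo_matrix (k : fieldType) (c : P -> P -> k) : Prop :=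
  [/\ forall g p q p' q', st g p = Some p' -> st g q = Some q' -> c p' q' = c p q,
      forall g p p' q', st g p = Some p' -> vtx q' = tgt g ->
        (forall q, st g q <> Some q') -> c p' q' = 0,
      forall g p q q', vtx p = src g -> st g p = None -> st g q = Some q' ->
        c p q = 0
    & forall p q, vtx p <> vtx q -> c p q = 0].

Definition all_scalar (k : fieldType) : Prop :=
  forall c : P -> P -> k, endo_matrix c ->
    exists l, forall p q, c p q = if p == q then l else 0.

Definition graph_map (h : P -> option P) : Prop :=
  (forall p q, h p = Some q -> vtx q = vtx p) /\
  (forall g p, vtx p = src g -> obind h (st g p) = obind (st g) (h p)).

Definition graph_maps_trivial : Prop :=
  forall h, graph_map h -> forall p q, h p = Some q -> p = q.

End EndomorphismConditions.

(** * Bricks, endomorphism matrices and graph maps *)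

Section BrickCriteria.
Variables (k : fieldType) (w : infword letter) (ws : is_string w).
Local Notation M := (string_module k ws).
Local Notation V := (@string_space k w).
Implicit Types (g : arrow) (p q : pos w).

Lemma vertex_at_step_src g p q : step g p = Some q -> vertex_at p = src g.
Proof.
case: w p q ws => f /= p q fs.
- case: eqP => [-> //|_]; case: p => // p; case: eqP => // fp _.
  by case: (string_consecutive fs (factor2_right f p)) => <-; rewrite fp.
- case: eqP => [-> //|_]; case: p => // p; case: eqP => // fp _.
  by case: (string_consecutive fs (factor2_left f p)) => ->; rewrite fp.
- case: eqP => [-> //|_]; case: eqP => // fp _.
  have := string_consecutive fs (factor2_double f (p - 1)).
  by rewrite subrK => -[<- _ _]; rewrite fp.
Qed.

(** Two different preimages would put [g] next to its inverse at [r], against reducedness. *)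
Lemma step_inj g p q r : step g p = Some r -> step g q = Some r -> p = q.
Proof.
case: w p q r ws => f /= p q r fs.
- have Hf i : f i = (g, true) -> f i.+1 = (g, false) -> False.
    move=> fi fi1; have [_ + _] := string_consecutive fs (factor2_right f i).
    by rewrite fi fi1.
  case: eqP => [fp [<-]|_].
    case: eqP => [fq [] //|_]; case: q => // q; case: eqP => // fq [qE].
    by case: (Hf p); rewrite // -qE.
  case: p => // p; case: eqP => // fp [pE]; subst r.
  case: eqP => [fq [qE]|_]; first by case: (Hf q); rewrite // qE.
  by case: q => // q; case: eqP => // fq [->].
- have Hf i : f i = (g, false) -> f i.+1 = (g, true) -> False.
    move=> fi fi1; have [_ + _] := string_consecutive fs (factor2_left f i).
    by rewrite fi fi1.
  case: eqP => [fp [<-]|_].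
    case: eqP => [fq [] //|_]; case: q => // q; case: eqP => // fq [qE].
    by case: (Hf p); rewrite // -qE.
  case: p => // p; case: eqP => // fp [pE]; subst r.
  case: eqP => [fq [qE]|_]; first by case: (Hf q); rewrite // qE.
  by case: q => // q; case: eqP => // fq [->].
- have Hf i : f i = (g, true) -> f (i + 1) = (g, false) -> False.
    move=> fi fi1; have [_ + _] := string_consecutive fs (factor2_double f i).
    by rewrite fi fi1.
  case: eqP => [fp [<-]|_].
    case: eqP => [fq [] /addIr -> //|_]; case: eqP => // fq [qE].
    by case: (Hf p) => //; rewrite -qE.
  case: eqP => // fp [<-].
  case: eqP => [fq [qE]|_]; first by case: (Hf q) => //; rewrite qE.
  by case: eqP => // fq [/addIr].
Qed.

(** Total in its argument, with value 0 on [None] and on positions at another vertex, so that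
    statements about arrows need no transport between dependent types. *)
Definition basis_vect i (o : option (pos w)) : V i :=
  if obind insub o is Some y then << y >> else 0.

Lemma basis_vect_val i (x : basis_at w i) : basis_vect i (Some (val x)) = << x >>.
Proof. by rewrite /basis_vect /= valK. Qed.

Lemma basis_vectE i p (ip : vertex_at p == i) :
  basis_vect i (Some p) = << exist _ p ip : basis_at w i >>.
Proof. by rewrite /basis_vect /= insubT. Qed.

Lemma string_action_basis_vect g (o : option (pos w)) :
  (forall p, o = Some p -> vertex_at p = src g) ->
  string_action k w g (basis_vect (src g) o) =
  basis_vect (tgt g) (obind (step g) o).
Proof.
case: o => [p|_] /=; last exact: raddf0.
by move=> /(_ _ erefl)/eqP ip; rewrite basis_vectE /= fglift1.
Qed.

Definition coord i q (D : V i) : k^o :=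
  if insub q : option (basis_at w i) is Some y then coeff y D else 0.

Lemma coord_is_linear i q : linear (@coord i q).
Proof.
move=> a D D'; rewrite /coord; case: insubP => [y _ _|_].
  by rewrite coeffD coeffZ.
by rewrite scaler0 addr0.
Qed.

HB.instance Definition _ i q :=
  GRing.isLinear.Build k (V i) k^o *:%R (@coord i q) (@coord_is_linear i q).

Lemma coord_basis i (x : basis_at w i) q :
  coord q (<< x >> : V i) = (val x == q)%:R.
Proof.
rewrite /coord; case: insubP => [y _ <-|]; first by rewrite coeffU mul1r val_eqE.
by apply: contraNeq => /eqP; case: eqP => [<- _|//]; exact: (valP x).
Qed.

Lemma coord_basis_vect i o q : (forall p, o = Some p -> vertex_at p = i) ->
  coord q (basis_vect i o) = (o == Some q)%:R.
Proof.
case: o => [p|_]; last exact: (raddf0 (@coord i q)).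
by move=> /(_ _ erefl)/eqP ip; rewrite basis_vectE coord_basis.
Qed.

Lemma coord_action g (D : V (src g)) q q' : step g q = Some q' ->
  coord q' (string_action k w g D) = coord q D.
Proof.
move=> gq; apply: (@freeg_lin_ext _ _ _ (@coord _ q' \o string_action k w g)
  (@coord _ q)) => x /=.
rewrite -basis_vect_val string_action_basis_vect /=; last first.
  by move=> p [<-]; exact/eqP/(valP x).
rewrite !coord_basis_vect; last 2 first.
- by move=> p [<-]; exact/eqP/(valP x).
- by move=> p /(vertex_at_step ws).
congr (nat_of_bool _)%:R; apply/eqP/eqP => [gx|[->]] //.
by rewrite (step_inj gx gq).
Qed.

Lemma coord_action0 g (D : V (src g)) q' : (forall q, step g q <> Some q') ->
  coord q' (string_action k w g D) = 0.
Proof.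
move=> gq; apply: (@freeg_lin_ext _ _ _ (@coord _ q' \o string_action k w g)
  \0) => x /=.
rewrite -basis_vect_val string_action_basis_vect /=; last first.
  by move=> p [<-]; exact/eqP/(valP x).
rewrite coord_basis_vect; last by move=> p /(vertex_at_step ws).
by case: eqP => // /gq.
Qed.

Definition endo_coeff (phi : forall i, {linear V i -> V i}) p q : k :=
  coord q (phi (vertex_at p) (basis_vect (vertex_at p) (Some p))).

Lemma endo_coeffE (phi : forall i, {linear V i -> V i}) i p q :
  vertex_at p = i -> coord q (phi i (basis_vect i (Some p))) = endo_coeff phi p q.
Proof. by move=> <-. Qed.

Lemma endo_coeff_matrix (phi : forall i, {linear V i -> V i}) :
  @is_endomorphism k M phi ->
  endo_matrix (@vertex_at w) (@step w) (endo_coeff phi).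
Proof.
move=> phiE.
have key g p (p' : option (pos w)) : vertex_at p = src g -> step g p = p' ->
    phi (tgt g) (basis_vect (tgt g) p') =
    string_action k w g (phi (src g) (basis_vect (src g) (Some p))).
  move=> vp gp; rewrite -phiE /= string_action_basis_vect /= ?gp //.
  by move=> _ [<-].
split.
- move=> g p q p' q' gp gq; have vp := vertex_at_step_src gp.
  rewrite -(endo_coeffE _ _ (vertex_at_step ws gp)) -(endo_coeffE _ _ vp).
  by rewrite (key _ _ _ vp gp) (coord_action _ gq).
- move=> g p p' q' gp _ gq; have vp := vertex_at_step_src gp.
  rewrite -(endo_coeffE _ _ (vertex_at_step ws gp)) (key _ _ _ vp gp).
  exact: coord_action0.
- move=> g p q q' vp gp gq; rewrite -(endo_coeffE _ _ vp) -(coord_action _ gq).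
  rewrite -(key _ _ _ vp gp) /basis_vect /= raddf0; exact: (raddf0 (@coord _ _)).
- move=> p q pq; rewrite /endo_coeff /coord; case: insubP => // y /eqP vq.
  by case: pq.
Qed.

Lemma brick_all_scalar : (exists p : pos w, True) ->
  all_scalar (@vertex_at w) (@step w) k -> brick M.
Proof.
move=> [p0 _] sc; split.
  exists (vertex_at p0), (basis_vect (vertex_at p0) (Some p0) : V _).
  rewrite basis_vectE; apply/eqP => /(congr1 (coord p0)).
  rewrite coord_basis eqxx (raddf0 (@coord _ _)); exact/eqP/oner_neq0.
move=> phi phiE [i [D phiD]].
have [l lE] := sc _ (endo_coeff_matrix phiE).
have phiZ j (x : V j) : phi j x = l *: x.
  apply: (@freeg_lin_ext _ _ _ (phi j) (l \*: idfun)) => {x} x /=.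
  apply/eqP/freeg_eqP => y; have vx := eqP (valP x).
  have cE D' : coeff y D' = coord (val y) D' by rewrite /coord valK.
  rewrite !cE -[<< x >>]basis_vect_val (endo_coeffE _ _ vx) lE.
  rewrite (linearZ_LR (@coord j (val y))) /= coord_basis_vect => [|p [<-] //].
  rewrite (inj_eq (@Some_inj _)); case: eqP => _.
    by rewrite [RHS]mulr1.
  by rewrite [RHS]mulr0.
have l0 : l != 0.
  by apply: contraNneq phiD => l0; rewrite phiZ l0 scale0r.
exists (fun j => l^-1 \*: idfun); split.
  by move=> g x; rewrite /= linearZ.
by move=> j; split=> x /=; rewrite phiZ scalerA ?mulVf ?mulfV ?scale1r.
Qed.

(** A nontrivial [h] induces an endomorphism [phi]; either [phi] or [phi'], its difference with the
    identity, is nonzero and not invertible, according to whether [h] is partial or total. *)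
Lemma brick_graph_maps_trivial : brick M ->
  graph_maps_trivial (@vertex_at w) (@step w).
Proof.
move=> [_ Mb] h [hv hs] p q hp; apply: contrapT => pq.
pose phi i : {linear V i -> V i} :=
  fglift (fun x : basis_at w i => basis_vect i (h (val x))).
pose phi' i : {linear V i -> V i} :=
  fglift (fun x : basis_at w i =>
    basis_vect i (Some (val x)) - basis_vect i (h (val x))).
have phi'B i : phi' i =1 idfun \- phi i.
  apply: freeg_lin_ext => x.
  by rewrite /= !fglift1 basis_vect_val.
have phib i o : phi i (basis_vect i o) = basis_vect i (obind h o).
  rewrite [in LHS]/basis_vect; case: o => [r|] /=; last exact: raddf0.
  case: insubP => [x _ xr|rn]; first by rewrite /phi fglift1 xr.
  rewrite raddf0 /basis_vect; case hr: (h r) => [s|] //=.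
  by rewrite insubN // (hv _ _ hr).
have phiE : @is_endomorphism k M phi.
  move=> g; apply: (@freeg_lin_ext _ _ _ (phi (tgt g) \o string_action k w g)
    (string_action k w g \o phi (src g))) => x /=.
  have vx := eqP (valP x).
  rewrite -basis_vect_val string_action_basis_vect => [|r [<-] //].
  rewrite !phib /= string_action_basis_vect ?hs //.
  by move=> r /hv ->.
have phi'E : @is_endomorphism k M phi'.
  by move=> g x; rewrite !phi'B /= phiE raddfB.
(* Where [h] is undefined, [phi] kills a basis vector, so it is not injective. *)
have [hN|] := pselect (exists r, h r = None).
  have [r hr] := hN; have [|psi [_ psiK]] := Mb _ phiE.
    exists (vertex_at p), (basis_vect _ (Some p)); rewrite phib /= hp.
    rewrite basis_vectE ?(hv _ _ hp) //= => vq.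
    apply/eqP => /(congr1 (coord q)).
    rewrite coord_basis eqxx (raddf0 (@coord _ _)); exact/eqP/oner_neq0.
  have [psiK1 _] := psiK (vertex_at r).
  have := psiK1 (basis_vect _ (Some r)); rewrite phib /= hr raddf0.
  rewrite basis_vectE => /(congr1 (coord r)).
  rewrite coord_basis eqxx (raddf0 (@coord _ _)) => /esym; exact/eqP/oner_neq0.
move=> /forallNP hT.
have [|psi [_ psiK]] := Mb _ phi'E.
  exists (vertex_at p), (basis_vect _ (Some p)); rewrite phi'B /= phib /= hp.
  apply/eqP => /(congr1 (coord p)).
  rewrite (raddfB (@coord _ _)) (raddf0 (@coord _ _)) /=.
  rewrite !coord_basis_vect => [|_ [<-]|_ [<-]] //; last exact: hv hp.
  by rewrite eqxx; case: eqP => [[/esym]//|_ /eqP]; rewrite subr0 oner_eq0.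
have [_ psiK2] := psiK (vertex_at p).
(* The sum of the coefficients: a total [h] preserves it, so it vanishes on the image of [phi'],
   which is therefore not surjective. *)
pose aug : {linear V (vertex_at p) -> k^o} := fglift (fun=> 1 : k^o).
have augb r : vertex_at r = vertex_at p ->
    aug (basis_vect _ (Some r)) = 1.
  by move=> /eqP vr; rewrite basis_vectE; exact: fglift1.
have aug0 D : aug (phi' _ D) = 0.
  apply: (@freeg_lin_ext _ _ _ (aug \o phi' _) \0) => x.
  have vx := eqP (valP x).
  apply: etrans (congr1 aug (fglift1 _ _)) _; apply: etrans (raddfB aug _ _) _.
  apply/eqP; rewrite subr_eq0; apply/eqP; apply: etrans (augb _ vx) (esym _).
  case hx : (h (val x)) => [r|]; last by case: (hT (val x)).
  by apply: augb; rewrite (hv _ _ hx).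
have := aug0 (psi _ (basis_vect _ (Some p))).
by rewrite psiK2 augb // => /eqP; rewrite oner_eq0.
Qed.

End BrickCriteria.

(** [v] encodes a word over the blocks a and b: [v n] is [1] or [3] if the
    [n]-th block is a or b, and a value [0], [2] or [4] on the left of a
    right-infinite word says that half of a block a, no block, or half of a
    block b precedes it.  [node n] is the position between the blocks [n - 1]
    and [n], and [middle n] is the position inside the block [n]. *)
Definition block (v : int -> nat) (n : int) : bool := (v n == 1) || (v n == 3).

(** One interface for right- and double-infinite strings in both orientations: exchanging the
    indices 1 and 2 of all arrows exchanges the two cases of [model_arrows]. In a block a the middle
    maps to both neighbouring nodes, in a block b both nodes map to the middle; a half block keeps
    only the arrow at its right node. By [block_start] there is at most one start. *)
Record block_model (P : eqType) (vtx : P -> vertex) (st : arrow -> P -> option P)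
    (x1 x2 y1 y2 : arrow) (v : int -> nat) := BlockModel {
  node : int -> P;
  middle : int -> P;
  locate : P -> int * bool;
  model_arrows : [/\ x1 = alpha1, x2 = alpha2, y1 = beta1 & y2 = beta2] \/
    [/\ x1 = alpha2, x2 = alpha1, y1 = beta2 & y2 = beta1];
  step_src : forall g p q, st g p = Some q -> vtx p = src g;
  block0 : block v 0;
  blockS : forall n, block v n -> block v (n + 1);
  block_start : forall n m, block v (n + 1) -> block v (m + 1) ->
    ~~ block v n -> ~~ block v m -> n = m;
  value_le4 : forall n, (v n <= 4)%N;
  model_cover : forall p,
    let: (n, c) := locate p in
    if c then [/\ block v (n + 1), v n != 2%N & p = middle n]
    else block v n /\ p = node n;
  locate_node : forall n, block v n -> locate (node n) = (n, false);
  locate_middle : forall n, block v (n + 1) -> v n != 2%N ->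
    locate (middle n) = (n, true);
  vertex_node : forall n, block v n -> vtx (node n) = v2;
  vertex_middle : forall n, block v (n + 1) -> v n != 2%N ->
    vtx (middle n) = if (v n <= 1)%N then v1 else v3;
  step_x1 : forall n, block v (n + 1) -> (v n <= 1)%N ->
    st x1 (middle n) = if v n == 1%N then Some (node n) else None;
  step_x2 : forall n, block v (n + 1) -> (v n <= 1)%N ->
    st x2 (middle n) = Some (node (n + 1));
  step_y1 : forall n, block v n ->
    st y1 (node n) = if v n == 3%N then Some (middle n) else None;
  step_y2 : forall n, block v (n + 1) ->
    st y2 (node (n + 1)) = if (3 <= v n)%N then Some (middle n) else None
}.

Definition ge_right (v : int -> nat) (n m : int) : Prop := forall t : nat,
  (forall s : nat, (s < t)%N -> v (n + s%:Z) = v (m + s%:Z)) ->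
  (v (m + t%:Z)%R <= v (n + t%:Z)%R)%N.

Definition ge_left (v : int -> nat) (n m : int) : Prop := forall t : nat,
  (forall s : nat, (s < t)%N -> v (n - 1 - s%:Z) = v (m - 1 - s%:Z)) ->
  (v (m - 1 - t%:Z)%R <= v (n - 1 - t%:Z)%R)%N.

(** With [n] as source and [m] as target, a larger letter of the source at the
    first mismatch leaves the entry free, a smaller one forces it to be [0]. *)
Definition incomparable (v : int -> nat) : Prop := forall n m : int,
  block v n -> block v m -> n <> m -> ge_right v n m -> ge_left v n m -> False.

(** * Propagation and vanishing of matrix entries *)

Section BlockModelTheory.
Variables (P : eqType) (vtx : P -> vertex) (st : arrow -> P -> option P).
Variables (x1 x2 y1 y2 : arrow) (v : int -> nat).
Variable B : block_model vtx st x1 x2 y1 y2 v.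
Local Notation E := (node B).
Local Notation Mid := (middle B).

Let src_arrows : [/\ src x1 = v1, src x2 = v1, src y1 = v2 & src y2 = v2].
Proof. by case: (model_arrows B) => -[-> -> -> ->]. Qed.

Let tgt_arrows : [/\ tgt x1 = v2, tgt x2 = v2, tgt y1 = v3 & tgt y2 = v3].
Proof. by case: (model_arrows B) => -[-> -> -> ->]. Qed.

(** A value other than 1 and 3 precedes a block only at the start, which is unique; so equal values
    to the left of two different nodes are blocks. *)
Lemma block_prev n m : block v n -> block v m -> n <> m ->
  v (n - 1) = v (m - 1) -> block v (n - 1) /\ block v (m - 1).
Proof.
move=> bn bm nm vE; have bE : block v (n - 1) = block v (m - 1) by rewrite /block vE.
case bn1: (block v (n - 1)); first by rewrite -bE bn1.
case: nm; apply: (addIr (-1)); apply: (block_start B); rewrite ?subrK ?bn1 //.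
by rewrite -bE bn1.
Qed.

(** Half a block b lacks its arrow [y1], and [y1] reaches only middles of value 3. *)
Lemma middle_not_image n q : block v (n + 1) -> v n = 4%N -> st y1 q <> Some (Mid n).
Proof.
move=> bn vn yq; have [_ _ sy _] := src_arrows.
have := step_src B yq; rewrite sy; have := model_cover B q.
case: (locate B q) => m [[bm vm ->]|[bm qE]].
  by rewrite vertex_middle //; case: ifP.
move: yq; rewrite qE step_y1 //; case: eqP => // vm [/(congr1 (locate B))].
rewrite !locate_middle ?vm ?vn //; first by case=> mn; move: vm; rewrite mn vn.
exact: (blockS B).
Qed.

Lemma node_not_image n q : block v (n + 1) -> v n = 2%N ->
  st x2 q <> Some (E (n + 1)).
Proof.
move=> bn vn xq; have [_ sx _ _] := src_arrows.
have := step_src B xq; rewrite sx; have := model_cover B q.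
case: (locate B q) => m [[bm vm qE]|[bm ->]]; last by rewrite vertex_node.
rewrite qE vertex_middle //; case: ifP => // vm1 _.
move: xq; rewrite qE step_x2 // => -[/(congr1 (locate B))].
by rewrite !locate_node // => -[/addIr mn]; move: vm; rewrite mn vn.
Qed.

Section Matrix.
Variables (k : fieldType) (c : P -> P -> k).
Hypothesis cE : endo_matrix vtx st c.
Local Notation C n m := (c (E n) (E m)).

(** A common block carries the entry from its left node to its right node through its middle, with
    one equality for each of its two arrows. *)
Lemma node_coeffS n m : block v n -> block v m -> v n = v m ->
  C (n + 1) (m + 1) = C n m.
Proof.
case: cE => M1 _ _ _ bn bm vE; have [bn1 bm1] := (blockS B bn, blockS B bm).
case/orP: (bn) => /eqP vn; have vm := vn; rewrite vE in vm.
  rewrite (M1 x2 (Mid n) (Mid m) (E (n + 1)) (E (m + 1))) ?step_x2 ?vn ?vm //.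
  by rewrite -(M1 x1 (Mid n) (Mid m) (E n) (E m)) ?step_x1 ?vn ?vm.
rewrite -(M1 y2 (E (n + 1)) (E (m + 1)) (Mid n) (Mid m)) ?step_y2 ?vn ?vm //.
by rewrite (M1 y1 (E n) (E m) (Mid n) (Mid m)) ?step_y1 ?vn ?vm.
Qed.

Lemma node_coeff0 n m : block v n -> block v m -> (v n < v m)%N -> C n m = 0.
Proof.
case: cE => _ _ M3 _ bn bm vlt; have [_ _ sy _] := src_arrows.
have [vn vm] : v n = 1%N /\ v m = 3%N by move: bn bm vlt; rewrite /block; lia.
by rewrite (M3 y1 _ _ (Mid m)) ?step_y1 ?vertex_node ?sy ?vn ?vm.
Qed.

(** Four obstructions cover all pairs of values: [y2] kills only the source; only the source lies in
    the image of [x2]; for 3 against 4, one step along [y2], only the source lies in the image of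
    [y1]; for 0 against 1, one step back along [x2], [x1] kills only the source. *)
Lemma node_coeffS0 n m : block v (n + 1) -> block v (m + 1) -> (v n < v m)%N ->
  C (n + 1) (m + 1) = 0.
Proof.
case: cE => M1 M2 M3 _ bn bm vlt; have [sx _ _ sy] := src_arrows.
have [_ tx ty _] := tgt_arrows; have vm4 := value_le4 B m.
case: (leqP 3 (v m)) => vm.
  case: (leqP 3 (v n)) => vn; last first.
    by rewrite (M3 y2 _ _ (Mid m)) ?step_y2 ?vm ?vertex_node ?sy // leqNgt vn.
  rewrite -(M1 y2 (E (n + 1)) (E (m + 1)) (Mid n) (Mid m)) ?step_y2 ?vn ?vm //.
  have vn3 : v n = 3%N by lia.
  have vm4' : v m = 4%N by lia.
  apply: (M2 y1 (E n)); first by rewrite step_y1 /block vn3.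
    by rewrite vertex_middle // vm4'.
  by move=> q; exact: middle_not_image.
have vn : (v n <= 1)%N by lia.
case: (eqVneq (v m) 2%N) => vm2.
  apply: (M2 x2 (Mid n)); rewrite ?step_x2 ?vertex_node //.
  by move=> q; exact: node_not_image.
have vm1 : v m = 1%N by lia.
have vn0 : v n = 0%N by lia.
rewrite (M1 x2 (Mid n) (Mid m) (E (n + 1)) (E (m + 1))) ?step_x2 ?vm1 //.
by rewrite (M3 x1 _ _ (E m)) ?step_x1 ?vertex_middle ?vn0 ?vm1 ?sx.
Qed.

Lemma node_coeff_right n m t : block v n -> block v m ->
  (forall s : nat, (s < t)%N -> v (n + s%:Z) = v (m + s%:Z)) ->
  [/\ block v (n + t%:Z), block v (m + t%:Z) & C (n + t%:Z) (m + t%:Z) = C n m].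
Proof.
move=> bn bm; elim: t => [|t IH] vE; first by rewrite !addr0.
have [|bnt bmt <-] := IH; first by move=> s st'; apply: vE; exact: ltnW.
have E1 i : i + t.+1%:Z = i + t%:Z + 1 by lia.
by rewrite !E1; split; [exact: (blockS B)..|apply: node_coeffS => //; exact: vE].
Qed.

Lemma node_coeff_left n m t : n <> m -> block v n -> block v m ->
  (forall s : nat, (s < t)%N -> v (n - 1 - s%:Z) = v (m - 1 - s%:Z)) ->
  [/\ block v (n - t%:Z), block v (m - t%:Z) & C (n - t%:Z) (m - t%:Z) = C n m].
Proof.
move=> nm bn bm; elim: t => [|t IH] vE; first by rewrite !subr0.
have [|bnt bmt <-] := IH; first by move=> s st'; apply: vE; exact: ltnW.
have E1 i : i - t.+1%:Z = i - t%:Z - 1 by lia.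
have E2 i : i - 1 - t%:Z = i - t%:Z - 1 by lia.
have vt := vE _ (ltnSn t); rewrite !E2 in vt.
have nmt : n - t%:Z <> m - t%:Z by move=> /addIr.
have [bn' bm'] := block_prev bnt bmt nmt vt.
by rewrite !E1; split=> //; rewrite -(node_coeffS bn' bm' vt) !subrK.
Qed.

(** A nonzero entry travels unchanged to the first mismatch on either side, where it survives only
    if the source letter is the larger one; it would make [n] dominate [m] on both sides. *)
Lemma node_coeff_offdiag n m : incomparable v -> block v n -> block v m ->
  n <> m -> C n m = 0.
Proof.
move=> W bn bm nm; apply: contrapT => C0; apply: (W n m bn bm nm) => t vE.
  rewrite leqNgt; apply/negP => vlt; apply: C0.
  by have [bnt bmt <-] := node_coeff_right bn bm vE; exact: node_coeff0.
rewrite leqNgt; apply/negP => vlt; apply: C0.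
have [bnt bmt <-] := node_coeff_left nm bn bm vE.
have E2 i : i - t%:Z = i - 1 - t%:Z + 1 by lia.
by move: bnt bmt; rewrite (E2 n) (E2 m) => bnt bmt; exact: node_coeffS0.
Qed.

Lemma node_coeff_diag n : block v n -> C n n = C 0 0.
Proof.
move=> bn; have bz := block0 B.
(* Leftward propagation excludes equal positions, so a negative [n] is joined to 0 by moving right
   from [n]. *)
case: (leP 0 n) => [n0|n0].
  have [//|_ _] := @node_coeff_right 0 0 `|n|%N bz bz.
  by have -> : 0 + `|n|%N%:Z = n by lia.
have [//|_ _] := @node_coeff_right n n `|n|%N bn bn.
by have -> : n + `|n|%N%:Z = 0 by lia.
Qed.

(** The right node is used because a half block has no left one. *)
Lemma middle_coeff n m : block v (n + 1) -> block v (m + 1) ->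
  v n != 2%N -> v m != 2%N -> vtx (Mid n) = vtx (Mid m) ->
  c (Mid n) (Mid m) = C (n + 1) (m + 1).
Proof.
case: cE => M1 _ _ _ bn bm vn vm; rewrite !vertex_middle //.
case: (leqP (v n) 1) => vn1; case: (leqP (v m) 1) => vm1 // _.
  by rewrite -(M1 x2 (Mid n) (Mid m) (E (n + 1)) (E (m + 1))) ?step_x2.
have vn3 : (3 <= v n)%N by lia.
have vm3 : (3 <= v m)%N by lia.
by rewrite (M1 y2 (E (n + 1)) (E (m + 1)) (Mid n) (Mid m)) ?step_y2 ?vn3 ?vm3.
Qed.

End Matrix.

Lemma incomparable_all_scalar (k : fieldType) : incomparable v ->
  all_scalar vtx st k.
Proof.
move=> W c cE; exists (c (E 0) (E 0)) => p q.
case: (pselect (vtx p = vtx q)) => pq; last first.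
  by case: cE => _ _ _ -> //; case: eqP => // pq'; case: pq; rewrite pq'.
have := model_cover B p; have := model_cover B q.
case: (locate B q) => m [[bm vm qE]|[bm qE]];
case: (locate B p) => n [[bn vn pE]|[bn pE]]; move: pq; rewrite pE qE => pq.
- rewrite middle_coeff //; case: eqP => [/(congr1 (locate B))|] nm.
    move: nm; rewrite !locate_middle // => -[->]; exact: node_coeff_diag.
  by apply: node_coeff_offdiag => // /addIr nm'; apply: nm; rewrite nm'.
- by move: pq; rewrite vertex_node // vertex_middle //; case: ifP.
- by move: pq; rewrite vertex_node // vertex_middle //; case: ifP.
- case: eqP => [/(congr1 (locate B))|] nm.
    move: nm; rewrite !locate_node // => -[->]; exact: node_coeff_diag.
  by apply: node_coeff_offdiag => // nm'; apply: nm; rewrite nm'.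
Qed.

End BlockModelTheory.

(** * The graph map of a dominating pair *)

Section DominanceGraphMap.
Variables (P : eqType) (vtx : P -> vertex) (st : arrow -> P -> option P).
Variables (x1 x2 y1 y2 : arrow) (v : int -> nat).
Variable B : block_model vtx st x1 x2 y1 y2 v.
Variables n0 d : int.
Hypotheses (bn0 : block v n0) (bm0 : block v (n0 + d)).
Hypotheses (geR : ge_right v n0 (n0 + d)) (geL : ge_left v n0 (n0 + d)).
Local Notation E := (node B).
Local Notation Mid := (middle B).

(** The nodes reached from [n0] along letters equal to their translates by [d]; the two ranges of
    [z] serve nodes to the right and to the left of [n0]. *)
Definition agree_to (n : int) : Prop := [/\ block v n, block v (n + d)
  & forall z, (n0 <= z < n) || (n <= z < n0) -> v z = v (z + d)].

Lemma agree_toS (n : int) : block v n -> block v (n + d) -> v n = v (n + d) ->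
  agree_to n <-> agree_to (n + 1).
Proof.
move=> bn bm vE; split=> -[_ _ vz].
  split; [exact: (blockS B)| |].
    by have -> : n + 1 + d = n + d + 1 by [lia]; exact: (blockS B).
  move=> z nz; case: (eqVneq z n) => [->//|zn]; apply: vz.
  by move: nz zn => /orP[] /andP[]; lia.
split=> // z nz; case: (eqVneq z n) => [->//|zn]; apply: vz.
by move: nz zn => /orP[] /andP[]; lia.
Qed.

(** From [n0] on this is the comparison [geR]; before [n0] the letter [n] still belongs to the
    agreeing stretch. *)
Lemma agree_to_right (n : int) : agree_to n -> (v (n + d)%R <= v n)%N.
Proof.
case=> _ _ vz; case: (leP n0 n) => nn.
  have := geR (t := `|n - n0|%N).
  have -> : n0 + d + `|n - n0|%N%:Z = n + d by lia.
  have -> : n0 + `|n - n0|%N%:Z = n by lia.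
  apply=> s sn; have -> : n0 + d + s%:Z = n0 + s%:Z + d by lia.
  by apply: vz; apply/orP; left; apply/andP; split; lia.
by rewrite -vz // lexx nn orbT.
Qed.

Lemma agree_to_left (n : int) : agree_to (n + 1) -> (v (n + d)%R <= v n)%N.
Proof.
case=> _ _ vz; case: (leP n0 n) => nn.
  by rewrite -vz // nn ltzD1 lexx.
have := geL (t := `|(n0 - 1 - n)%R|%N).
have -> : n0 + d - 1 - `|(n0 - 1 - n)%R|%N%:Z = n + d by lia.
have -> : n0 - 1 - `|(n0 - 1 - n)%R|%N%:Z = n by lia.
apply=> s sn; have -> : n0 + d - 1 - s%:Z = n0 - 1 - s%:Z + d by lia.
by apply: vz; apply/orP; right; apply/andP; split; lia.
Qed.

(** A middle follows the node on its right, and goes to 0 when its translate does not exist (value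
    2) or lies at another vertex. The letters themselves need not agree: a whole block may face a
    half block. *)
Definition shift_map (p : P) : option P :=
  let: (n, c) := locate B p in
  if c then
    if `[< agree_to (n + 1) >] && (v (n + d) != 2%N) &&
       ((v n <= 1) == (v (n + d)%R <= 1))%N
    then Some (Mid (n + d)) else None
  else if `[< agree_to n >] then Some (E (n + d)) else None.

Lemma shift_map_node (n : int) : block v n ->
  shift_map (E n) = if `[< agree_to n >] then Some (E (n + d)) else None.
Proof. by move=> bn; rewrite /shift_map locate_node. Qed.

Lemma shift_map_middle (n : int) : block v (n + 1) -> v n != 2%N ->
  shift_map (Mid n) =
  if `[< agree_to (n + 1) >] && (v (n + d) != 2%N) &&
     ((v n <= 1) == (v (n + d)%R <= 1))%N
  then Some (Mid (n + d)) else None.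
Proof. by move=> bn vn; rewrite /shift_map locate_middle. Qed.

(** By dominance the arrows at the ends of the source stretch leave it, so it spans a quotient, and
    those at the ends of the translated stretch enter it, so it spans a submodule; the map is the
    translation between the two. *)
Lemma shift_map_graph_map : graph_map vtx st shift_map.
Proof.
have [sx1 sx2 sy1 sy2] :
    [/\ src x1 = v1, src x2 = v1, src y1 = v2 & src y2 = v2].
  by case: (model_arrows B) => -[-> -> -> ->].
have Ed (n : int) : n + 1 + d = n + d + 1 by lia.
split=> [p q|g p].
  have := model_cover B p; case: (locate B p) => n [[bn vn ->]|[bn ->]].
    rewrite shift_map_middle //; case: asboolP => //= -[_ bm _].
    rewrite Ed in bm; case: ifP => // /andP[vm /eqP vE] [<-].
    by rewrite !vertex_middle // vE.
  rewrite shift_map_node //; case: asboolP => //= -[_ bm _] [<-].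
  by rewrite !vertex_node.
have g4 : [\/ g = x1, g = x2, g = y1 | g = y2].
  case: (model_arrows B) => -[-> -> -> ->]; case: (g);
  by [constructor 1|constructor 2|constructor 3|constructor 4].
have := model_cover B p; case: (locate B p) => n [[bn vn ->]|[bn ->]].
  rewrite vertex_middle //; case: ifP => vn1 sg; last by case: (g) sg.
  have {}g4 : g = x1 \/ g = x2.
    by case: g4 sg => ->; rewrite ?sx1 ?sx2 ?sy1 ?sy2 //; [left|right].
  (* For a middle at vertex 1 dominance forces [v (n + d) <= 1], so both extra guards hold. *)
  have mid_d : shift_map (Mid n) =
      if `[< agree_to (n + 1) >] then Some (Mid (n + d)) else None.
    rewrite shift_map_middle //; case: asboolP => //= /agree_to_left vE.
    have vd1 := leq_trans vE vn1.
    by rewrite vn1 vd1 eqxx; have -> : v (n + d) != 2%N by lia.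
  have vd : agree_to (n + 1) -> (v (n + d)%R <= 1)%N.
    by move=> /agree_to_left vE; exact: leq_trans vE vn1.
  have bd : agree_to (n + 1) -> block v (n + d + 1) by rewrite -Ed; case.
  case: g4 => ->; rewrite mid_d.
    rewrite step_x1 //; case: eqP => vn' /=.
      have bn' : block v n by rewrite /block vn'.
      rewrite shift_map_node //; case: asboolP => aE.
        have vm : v (n + d) = 1%N.
          have := agree_to_right aE; case: aE => _ + _; rewrite /block vn'; lia.
        have aE1 : agree_to (n + 1).
          by apply/(agree_toS bn') => //; [case: aE|rewrite vn' vm].
        by case: asboolP => //= _; rewrite step_x1 ?vm //; exact: bd.
      case: asboolP => //= aE1; rewrite step_x1 ?bd ?vd //; case: eqP => // vm.
      by case: aE; apply/(agree_toS bn'); rewrite /block ?vn' ?vm.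
    case: asboolP => //= aE1; rewrite step_x1 ?bd ?vd //; case: eqP => // vm.
    by have := agree_to_left aE1; rewrite vm; lia.
  rewrite step_x2 //= shift_map_node //; case: asboolP => //= aE1.
  by rewrite step_x2 ?bd ?vd // Ed.
rewrite vertex_node // => sg.
have {}g4 : g = y1 \/ g = y2.
  by case: g4 sg => ->; rewrite ?sx1 ?sx2 ?sy1 ?sy2 //; [left|right].
rewrite shift_map_node //; case: g4 => ->.
  rewrite step_y1 //; case: eqP => vn /=.
    rewrite shift_map_middle ?vn //; last exact: (blockS B).
    case: asboolP => aE1 /=; case: asboolP => aE //=.
    - have := agree_to_right aE; case: (aE) => _ bm _ vE; rewrite step_y1 //.
      by move: bm; rewrite /block => /orP[] /eqP ->.
    - case: ifP => // vm; case: aE.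
      have vE := agree_to_left aE1.
      have vm3 : v (n + d) = 3%N by lia.
      by apply/(agree_toS bn); rewrite /block ?vm3 ?vn.
    - case: (aE) => _ bm _; rewrite step_y1 //; case: eqP => // vm3.
      by case: aE1; apply/(agree_toS bn); rewrite ?vm3.
  case: asboolP => //= aE; have := agree_to_right aE; case: (aE) => _ bm _ vE.
  rewrite step_y1 //; case: eqP => // vm3.
  by move: bn vE; rewrite /block; lia.
(* [y2] acts on a node through the block on its left. *)
have nE : n = n - 1 + 1 by rewrite subrK.
move: bn; rewrite nE; set m := n - 1 => bm; rewrite step_y2 //.
case: ifP => vm /=.
  rewrite shift_map_middle //; last by apply/eqP => vm2; rewrite vm2 in vm.
  case: asboolP => //= aE; rewrite Ed step_y2; last by case: aE; rewrite Ed.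
  have vE := agree_to_left aE; have -> : (v m <= 1)%N = false by lia.
  case: (leqP 3 (v (m + d))) => vm3.
    have -> : (v (m + d)%R <= 1)%N = false by lia.
    by have -> : v (m + d) != 2%N by lia.
  by case: eqP => //= vm2; have -> : (v (m + d)%R <= 1)%N by lia.
case: asboolP => //= aE; rewrite Ed step_y2; last by case: aE; rewrite Ed.
by have vE := agree_to_left aE; case: ifP => //; lia.
Qed.

End DominanceGraphMap.

Lemma graph_maps_trivial_incomparable (P : eqType) (vtx : P -> vertex)
    (st : arrow -> P -> option P) (x1 x2 y1 y2 : arrow) (v : int -> nat) :
  block_model vtx st x1 x2 y1 y2 v -> graph_maps_trivial vtx st -> incomparable v.
Proof.
move=> B triv n m bn bm nm; have mE : m = n + (m - n) by rewrite addrC subrK.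
move: bm; rewrite mE => bm geR geL.
have := triv _ (shift_map_graph_map B bn bm geR geL) (node B n) (node B m).
rewrite shift_map_node //; case: asboolP => [_|[]]; last first.
  by split=> // z; case/orP => /andP[]; lia.
rewrite -mE in bm *; move=> /(_ erefl)/(congr1 (locate B)).
by rewrite !locate_node // => -[].
Qed.

(** * Lexicographic comparison *)

Section Lexicographic.
Implicit Types x y : nat -> nat.

(** Common form to which [ge_right] and [ge_left] both unfold. *)
Definition lex_ge x y : Prop :=
  forall t, (forall s, (s < t)%N -> x s = y s) -> (y t <= x t)%N.

Lemma lex_geI x y t : (forall s, (s < t)%N -> x s = y s) -> (y t < x t)%N ->
  lex_ge x y.
Proof.
move=> xy yt r xyr; case: (ltngtP r t) => [rt|tr|->]; last exact: ltnW.
  by rewrite xy.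
by move: yt; rewrite xyr // ltnn.
Qed.

Lemma lex_ge_refl x y : x =1 y -> lex_ge x y.
Proof. by move=> xy t _; rewrite xy. Qed.

Lemma first_mismatch x y : x =1 y \/
  exists2 t, x t != y t & forall s, (s < t)%N -> x s = y s.
Proof.
case: (pselect (exists t, x t != y t)) => [ex|/forallNP nex]; last first.
  by left=> t; apply/eqP; move/negP: (nex t); rewrite negbK.
right; case: (ex_minnP ex) => t xyt tmin; exists t => // s st.
by apply/eqP; apply: contraTT st => /tmin; rewrite -leqNgt.
Qed.

Lemma lex_geP x y : lex_ge x y -> x =1 y \/
  exists2 t, (y t < x t)%N & forall s, (s < t)%N -> x s = y s.
Proof.
move=> ge; case: (first_mismatch x y) => [|[t xyt xys]]; first by left.
by right; exists t => //; rewrite ltn_neqAle eq_sym xyt ge.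
Qed.

Lemma lex_ge_total x y : lex_ge x y \/ lex_ge y x.
Proof.
case: (first_mismatch x y) => [xy|[t xyt xys]].
  by left; apply: lex_ge_refl.
case: (ltngtP (x t) (y t)) => [lt|lt|/eqP]; last by rewrite (negPf xyt).
  by right; apply: lex_geI lt => s /xys.
by left; apply: lex_geI lt.
Qed.

End Lexicographic.

(** Equal right words are comparable both ways, and the left words are comparable in one of the two
    ways. *)
Lemma incomparable_no_right_repeat v n m : incomparable v ->
  block v n -> block v m -> n <> m ->
  ~ forall s : nat, v (n + s%:Z) = v (m + s%:Z).
Proof.
move=> W bn bm nm vE.
case: (lex_ge_total (fun s => v (n - 1 - s%:Z)) (fun s => v (m - 1 - s%:Z))) => geL.
  by apply: (W n m) => //; apply: lex_ge_refl.
by apply: (W m n) => //; [move/esym|apply: lex_ge_refl => s; rewrite vE].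
Qed.

Lemma incomparable_no_left_repeat v n m : incomparable v ->
  block v n -> block v m -> n <> m ->
  ~ forall s : nat, v (n - 1 - s%:Z) = v (m - 1 - s%:Z).
Proof.
move=> W bn bm nm vE.
case: (lex_ge_total (fun s => v (n + s%:Z)) (fun s => v (m + s%:Z))) => geR.
  by apply: (W n m) => //; apply: lex_ge_refl.
by apply: (W m n) => //; [move/esym|apply: lex_ge_refl => s; rewrite vE].
Qed.

(** * Counting b's in factors *)

Section Counting.
Implicit Types x y : nat -> bool.

Definition cnt x (L : nat) : nat := \sum_(s < L) x s.

Lemma cntS x L : cnt x L.+1 = (cnt x L + x L)%N.
Proof. by rewrite /cnt big_ord_recr. Qed.

Lemma cnt0 x : cnt x 0 = 0%N.
Proof. by rewrite /cnt big_ord0. Qed.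

Lemma cnt_head x L : cnt x L.+1 = (x 0%N + cnt (fun s => x s.+1) L)%N.
Proof. by rewrite /cnt big_ord_recl. Qed.

Lemma eq_cnt x y L : (forall s, (s < L)%N -> x s = y s) -> cnt x L = cnt y L.
Proof. by move=> xy; apply: eq_bigr => s _; rewrite xy. Qed.

Lemma cntD x i L : cnt x (i + L) = (cnt x i + cnt (fun s => x (i + s)%N) L)%N.
Proof.
elim: L => [|L IH]; first by rewrite addn0 cnt0 addn0.
by rewrite addnS !cntS IH addnA.
Qed.

Lemma cnt_neg x L : (cnt (fun s => ~~ x s) L + cnt x L = L)%N.
Proof. by elim: L => [|L IH]; rewrite ?cnt0 // !cntS; case: (x L) => /=; lia. Qed.

(** The excess of [cnt x] over [cnt y] moves by at most one at each step, so
    before it first reaches 2 it leaves 0 for the last time. *)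
Lemma cnt_excess x y L : (cnt y L + 2 <= cnt x L)%N ->
  exists l r, [/\ (l < r)%N, x l, ~~ y l, x r & ~~ y r] /\
    forall s, (l < s < r)%N -> x s = y s.
Proof.
move=> H; have exr : exists r, (cnt y r + 2 <= cnt x r)%N by exists L.
case: (ex_minnP exr) => r1 Hr rmin.
case: r1 Hr rmin => [|r]; first by rewrite !cnt0.
move=> Hr rmin; have {}rmin s : (s <= r)%N -> (cnt x s < cnt y s + 2)%N.
  by move=> sr; rewrite ltnNge; apply/negP => /rmin; lia.
have exl : exists l, (l <= r)%N && (cnt x l <= cnt y l)%N.
  by exists 0%N; rewrite !cnt0.
have bl l : (l <= r)%N && (cnt x l <= cnt y l)%N -> (l <= r)%N by case/andP.
case: (ex_maxnP exl bl) => l /andP[lr Hl] lmax.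
have {}lmax s : (l < s <= r)%N -> (cnt y s < cnt x s)%N.
  move=> /andP[ls sr]; rewrite ltnNge; apply/negP => le.
  by have := lmax s; rewrite sr le; lia.
have rr := rmin _ (leqnn r); move: (Hr); rewrite !cntS => Hr'.
have ltr : (l < r)%N.
  rewrite ltn_neqAle lr andbT; apply/eqP => lE; subst l.
  by move: Hr' Hl; case: (x r); case: (y r); lia.
have := lmax l.+1; rewrite ltnSn ltr => /(_ isT); rewrite !cntS => Hl1.
exists l, r; split.
  split=> //; first by move: Hl Hl1; case: (x l); case: (y l); lia.
  - by move: Hl Hl1; case: (x l); case: (y l); lia.
  - by move: Hr' rr; case: (x r); case: (y r); lia.
  - by move: Hr' rr; case: (x r); case: (y r); lia.
move=> s /andP[ls sr].
have := lmax s; rewrite ls ltnW // => /(_ isT) a1.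
have a2 := rmin _ (ltnW sr); have a3 := rmin _ sr.
have := lmax s.+1; rewrite ltnS (ltnW ls) sr => /(_ isT); move: a3; rewrite !cntS.
by case: (x s); case: (y s); lia.
Qed.

(** Converse of [cnt_excess], for the factors b t b and a t a. *)
Lemma excess_cnt x y T : x 0%N -> ~~ y 0%N ->
  (forall s, (s < T)%N -> x s.+1 = y s.+1) -> x T.+1 -> ~~ y T.+1 ->
  cnt x T.+2 = (cnt y T.+2 + 2)%N.
Proof.
move=> x0 y0 xy xT yT; rewrite !(cntS _ T.+1) !cnt_head (eq_cnt xy) x0 xT.
by rewrite (negPf y0) (negPf yT); lia.
Qed.

End Counting.

(** * Right-infinite words *)

Definition shift (i : nat) (u : nat -> bool) (t : nat) : bool := u (i + t)%N.
Definition bcons (c : bool) (u : nat -> bool) (t : nat) : bool :=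
  if t is s.+1 then u s else c.

Definition repeats (u : nat -> bool) : Prop :=
  exists N q, (0 < q)%N /\ forall t, u (N + t)%N = u (N + q + t)%N.

(** This is the balance of both [a u] and [b u], the former preventing an
    excess of b's over a prefix and the latter an excess of a's. *)
Definition extremal (u : nat -> bool) : Prop := forall i L,
  (cnt (shift i u) L <= (cnt (bcons false u) L).+1)%N /\
  (cnt (bcons true u) L <= (cnt (shift i u) L).+1)%N.

Definition characteristic_like (u : nat -> bool) : Prop :=
  extremal u /\ ~ repeats u.

(** [h] fills all negative indices, but only index -1 matters: reading to the left from two
    different nodes, a mismatch occurs at the latest when the first of them meets [h]. *)
Definition right_value (h : nat) (u : nat -> bool) (n : int) : nat :=
  if n is Posz i then if u i then 3%N else 1%N else h.

Lemma block_right h u n : h != 1%N -> h != 3%N ->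
  block (right_value h u) n = (0 <= n).
Proof.
move=> h1 h3; rewrite /block; case: n => [i|i] /=; first by case: (u i).
by rewrite (negPf h1) (negPf h3).
Qed.

Lemma right_valueD h u i t :
  right_value h u (i%:Z + t%:Z) = if u (i + t)%N then 3%N else 1%N.
Proof. by rewrite -PoszD. Qed.

Section RightWords.
Variables (h : nat) (u : nat -> bool).
Hypotheses (h1 : h != 1%N) (h3 : h != 3%N).
Local Notation v := (right_value h u).

Definition ordered_mismatches : Prop := forall i j T : nat, i <> j ->
  (forall s, (s < T)%N -> u (i + s)%N = u (j + s)%N) ->
  u (i + T)%N -> ~~ u (j + T)%N -> (v (i%:Z - 1)%R <= v (j%:Z - 1)%R)%N.

(** An agreement on the left can be moved to the right: starting instead at the left mismatch, the
    pair differs immediately on the left and agrees longer on the right. *)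
Lemma incomparable_rightP :
  incomparable v <-> ~ repeats u /\ ordered_mismatches.
Proof.
have vb (i : nat) : block v i%:Z by rewrite block_right.
split=> [W|[nr om]].
  split.
    move=> [N [q [q0 uE]]].
    apply: (incomparable_no_right_repeat W (vb N) (vb (N + q)%N)).
      by lia.
    by move=> s; rewrite !right_valueD uE.
  move=> i j T ij uE uiT ujT; rewrite leqNgt; apply/negP => lt.
  apply: (W i%:Z j%:Z) => //; first by lia.
    apply: (@lex_geI _ _ T) => [s sT|]; rewrite !right_valueD; first by rewrite uE.
    by rewrite uiT (negPf ujT).
  by apply: (@lex_geI _ _ 0) => //; rewrite !subr0.
move=> n m; rewrite !block_right //; case: n => // i _; case: m => // j _ ij.
have {}ij : i <> j by move=> ij'; apply: ij; rewrite ij'.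
move=> /lex_geP[uE|[T]].
  move=> _; apply: nr; case: (ltngtP i j) ij => // lt _.
    exists i, (j - i)%N; rewrite subn_gt0 lt subnKC 1?ltnW //; split=> // t.
    by have := uE t; rewrite !right_valueD; case: (u (i + t)%N); case: (u (j + t)%N).
  exists j, (i - j)%N; rewrite subn_gt0 lt subnKC 1?ltnW //; split=> // t.
  by have := uE t; rewrite !right_valueD; case: (u (i + t)%N); case: (u (j + t)%N).
rewrite !right_valueD => ltT uE.
have uiT : u (i + T)%N by move: ltT; case: (u (i + T)%N); case: (u _).
have ujT : ~~ u (j + T)%N by move: ltT; rewrite uiT; case: (u _).
have {}uE s : (s < T)%N -> u (i + s)%N = u (j + s)%N.
  move=> /uE; rewrite !right_valueD.
  by case: (u (i + s)%N); case: (u (j + s)%N).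
(* Both positions move left by [t], and the agreement on the right grows to [t + T]. *)
have step t : (t <= i)%N -> (t <= j)%N ->
    (forall s, (s < t)%N -> v (i%:Z - 1 - s%:Z) = v (j%:Z - 1 - s%:Z)) ->
    (v (i%:Z - 1 - t%:Z)%R <= v (j%:Z - 1 - t%:Z)%R)%N.
  move=> ti tj vE.
  have -> : i%:Z - 1 - t%:Z = (i - t)%N%:Z - 1 by lia.
  have -> : j%:Z - 1 - t%:Z = (j - t)%N%:Z - 1 by lia.
  apply: (om _ _ (t + T)%N); first by lia.
  - move=> s sT; case: (ltnP s t) => st.
      have := vE (t - s.+1)%N.
      have -> : i%:Z - 1 - (t - s.+1)%N%:Z = (i - t + s)%N%:Z by lia.
      have -> : j%:Z - 1 - (t - s.+1)%N%:Z = (j - t + s)%N%:Z by lia.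
      move=> /(_ ltac:(lia)) /=.
      by case: (u (i - t + s)%N); case: (u (j - t + s)%N).
    have -> : (i - t + s = i + (s - t))%N by lia.
    have -> : (j - t + s = j + (s - t))%N by lia.
    by apply: uE; lia.
  - by have -> : (i - t + (t + T) = i + T)%N by lia.
  - by have -> : (j - t + (t + T) = j + T)%N by lia.
move=> /lex_geP[vE|[t ltt vE]].
  (* At this distance one word shows [h] and the other a block. *)
  have := vE (minn i j); case: (ltngtP i j) ij => // lt _.
    have -> : i%:Z - 1 - i%:Z = - 1 by lia.
    have -> : j%:Z - 1 - i%:Z = (j - i).-1%:Z by lia.
    by move=> /= hE; move: h1 h3; rewrite hE; case: ifP.
  have -> : j%:Z - 1 - j%:Z = - 1 by lia.
  have -> : i%:Z - 1 - j%:Z = (i - j).-1%:Z by lia.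
  by move=> /= hE; move: h1 h3; rewrite -hE; case: ifP.
have tm : (t <= i)%N && (t <= j)%N.
  apply: contrapT => tm; have /vE : (minn i j < t)%N by lia.
  case: (ltngtP i j) ij => // lt _.
    have -> : i%:Z - 1 - i%:Z = - 1 by lia.
    have -> : j%:Z - 1 - i%:Z = (j - i).-1%:Z by lia.
    by move=> /= hE; move: h1 h3; rewrite hE; case: ifP.
  have -> : j%:Z - 1 - j%:Z = - 1 by lia.
  have -> : i%:Z - 1 - j%:Z = (i - j).-1%:Z by lia.
  by move=> /= hE; move: h1 h3; rewrite -hE; case: ifP.
case/andP: tm => ti tj; have := step _ ti tj vE; by rewrite leqNgt ltt.
Qed.

End RightWords.

(** Since 2 lies between 1 and 3, the start counts as an a against a preceding b and as a b against
    a preceding a. These two comparisons are the two inequalities of [extremal]. *)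
Lemma ordered_mismatches2P (u : nat -> bool) :
  ordered_mismatches 2 u <-> extremal u.
Proof.
have pE (n : nat) : n.+1%:Z - 1 = n%:Z by lia.
split=> [om i L|ex i j T ij uE uiT ujT].
  split; rewrite leqNgt; apply/negP => lt.
    have [|l [r [[lr xl yl xr yr] xy]]] := @cnt_excess (shift i u) (bcons false u) L.
      by lia.
    case: r lr xr yr xy => // r lr xr yr xy.
    (* The letter put in front shifts indices by one, so the stretch begins at [(i + l).+1] in the
       factor but at [l] in [u]. *)
    have := om (i + l).+1 l (r - l)%N ltac:(lia).
    have -> : ((i + l).+1 + (r - l) = i + r.+1)%N by lia.
    have -> : (l + (r - l) = r)%N by lia.
    have uE s : (s < r - l)%N -> u ((i + l).+1 + s)%N = u (l + s)%N.
      move=> sr; have := xy (l + s).+1 ltac:(lia).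
      by rewrite /shift addnS addnA addSn.
    move=> /(_ uE xr yr); have -> : (i + l).+1%:Z - 1 = (i + l)%N%:Z by lia.
    case: l yl xl {lr xy uE} => [|l] yl xl; rewrite ?pE /= [u _]xl //.
    by move: yl => /= /negPf ->.
  have [|l [r [[lr xl yl xr yr] xy]]] := @cnt_excess (bcons true u) (shift i u) L.
    by lia.
  case: r lr xr yr xy => // r lr xr yr xy.
  have := om l (i + l).+1 (r - l)%N ltac:(lia).
  have -> : ((i + l).+1 + (r - l) = i + r.+1)%N by lia.
  have -> : (l + (r - l) = r)%N by lia.
  have uE s : (s < r - l)%N -> u (l + s)%N = u ((i + l).+1 + s)%N.
    move=> sr; have := xy (l + s).+1 ltac:(lia).
    by rewrite /shift addnS addnA addSn.
  move=> /(_ uE xr yr); have -> : (i + l).+1%:Z - 1 = (i + l)%N%:Z by lia.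
  case: l yl xl {lr xy uE} => [|l] yl xl; rewrite ?pE /= [u (i + _)%N](negPf yl) //.
  by move: xl => /= ->.
have sh n s : shift n u s.+1 = u (n.+1 + s)%N by rewrite /shift addnS addSn.
have sh0 n : shift n u 0 = u n by rewrite /shift addn0.
case: i j ij uE uiT ujT => [|i] [|j] // ij uE uiT ujT;
  rewrite leqNgt; apply/negP => lt.
- move: lt; rewrite pE /=; case uj : (u j) => // _.
  have [_] := ex j T.+2; rewrite (@excess_cnt (bcons true u) (shift j u) T) //.
  + by lia.
  + by rewrite sh0 uj.
  + by move=> s /uE; rewrite sh.
  + by rewrite sh.
- move: lt; rewrite pE /=; case ui : (u i) => // _.
  have [+ _] := ex i T.+2; rewrite (@excess_cnt (shift i u) (bcons false u) T) //.
  + by lia.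
  + by rewrite sh0 ui.
  + by move=> s /uE; rewrite sh.
  + by rewrite sh.
- move: lt; rewrite !pE /=; case ui : (u i); case uj : (u j) => // _.
  (* Two inner factors are compared through the prefix of length [T.+1], preceded by a for the upper
     bound and by b for the lower one. *)
  have [c1 _] := ex i T.+2; have [_ c2] := ex j T.+2.
  move: c1 c2; rewrite (@excess_cnt (shift i u) (shift j u) T) //.
  + rewrite !(cnt_head (bcons _ _)) /=; lia.
  + by rewrite sh0 ui.
  + by rewrite sh0 uj.
  + by move=> s /uE; rewrite !sh.
  + by rewrite sh.
  + by rewrite sh.
Qed.

(** With the least value the start is harmless as a source; as a target it forbids later suffixes
    larger than [u]. For a word beginning with b, this and the inner comparisons amount to the
    extremality of the rest. *)
Lemma ordered_mismatches0P (u : nat -> bool) : ~ repeats u ->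
  ordered_mismatches 0 u <-> u 0%N /\ extremal (shift 1 u).
Proof.
move=> nr.
have pE (n : nat) : n.+1%:Z - 1 = n%:Z by lia.
have shw i s : shift i (shift 1 u) s = u (i + s).+1 by [].
have sh n s : shift n u s.+1 = u (n.+1 + s)%N by rewrite /shift addnS addSn.
have sh0 n : shift n u 0 = u n by rewrite /shift addn0.
split=> [om|[u0 ex] i j T ij uE uiT ujT].
  (* After an initial a, any later b would dominate the start; then [u] is constant. *)
  have u0 : u 0%N.
    apply: contrapT => /negP u0; apply: nr; exists 0%N, 1%N; split=> // t.
    have uF n : u n = false.
      case: n => [|n]; first exact: negbTE.
      apply/negP => un.
      have := om n.+1 0%N 0%N ltac:(lia) (fun s => ltac:(by rewrite ltn0)).
      by rewrite addn0 un (negPf u0) pE /= => /(_ isT isT); case: (u n).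
    by rewrite !uF.
  split=> // i L; split; rewrite leqNgt; apply/negP => lt.
    have [|l [r [[lr xl yl xr yr] xy]]] :=
        @cnt_excess (shift i (shift 1 u)) (bcons false (shift 1 u)) L; first by lia.
    case: r lr xr yr xy => // r lr xr yr xy; move: yr => /= yr.
    case: l lr xl yl xy => [|l] lr xl yl xy.
      (* The a put in front stands where [u] has its first b, which equals the letter of the factor
         there; the agreement thus extends to the start. *)
      have := om i.+1 0%N r.+1 ltac:(lia).
      have uE s : (s < r.+1)%N -> u (i.+1 + s)%N = u (0 + s)%N.
        case: s => [_|s sr]; first by rewrite addn0 u0 -xl shw addn0.
        by have := xy s.+1 ltac:(lia); rewrite shw /= /shift addSn => ->.
      move=> /(_ uE); rewrite addSn => /(_ xr yr).
      by rewrite pE /=; case: (u i).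
    have := om (i + l).+3 l.+2 (r - l.+1)%N ltac:(lia).
    have uE s : (s < r - l.+1)%N -> u ((i + l).+3 + s)%N = u (l.+2 + s)%N.
      move=> sr; have := xy (l.+2 + s)%N ltac:(lia).
      rewrite shw /= /shift add1n addSn; move=> /= <-; congr u; lia.
    move=> /(_ uE); have -> : ((i + l).+3 + (r - l.+1) = (i + r.+1).+1)%N by lia.
    have -> : (l.+2 + (r - l.+1) = r.+1)%N by lia.
    move=> /(_ xr yr); rewrite !pE /= -addnS -shw xl.
    by move: yl => /=; rewrite /shift add1n => /negPf ->.
  have [|l [r [[lr xl yl xr yr] xy]]] :=
      @cnt_excess (bcons true (shift 1 u)) (shift i (shift 1 u)) L; first by lia.
  have bE s : bcons true (shift 1 u) s = u s by case: s.
  have := om l.+1 (i + l).+2 (r - l.+1)%N ltac:(lia).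
  have uE s : (s < r - l.+1)%N -> u (l.+1 + s)%N = u ((i + l).+2 + s)%N.
    move=> sr; have := xy (l.+1 + s)%N ltac:(lia).
    rewrite bE shw => ->; congr u; lia.
  move=> /(_ uE); have -> : (l.+1 + (r - l.+1) = r)%N by lia.
  have -> : ((i + l).+2 + (r - l.+1) = (i + r).+1)%N by lia.
  rewrite -bE => /(_ xr yr); rewrite !pE /= -bE xl -shw.
  by rewrite (negPf yl).
case: i ij uE uiT ujT => [|i] // ij uE uiT ujT; rewrite leqNgt; apply/negP => lt.
case: j ij uE ujT lt => [|j] ij uE ujT lt.
  case: T uE uiT ujT => [|T] uE uiT ujT; first by rewrite u0 in ujT.
  have [+ _] := ex i T.+2.
  rewrite (@excess_cnt (shift i (shift 1 u)) (bcons false (shift 1 u)) T) //.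
  + by lia.
  + by rewrite shw addn0; have := uE 0%N isT; rewrite u0 addn0.
  + move=> s sT; have := uE s.+1 ltac:(lia); rewrite shw /= /shift add1n => <-.
    by rewrite addSn.
move: lt; rewrite !pE /=; case ui : (u i); case uj : (u j) => // _.
have ec : cnt (shift i u) T.+2 = (cnt (shift j u) T.+2 + 2)%N.
  apply: excess_cnt; rewrite ?sh0 ?sh ?ui ?uj // => s /uE; by rewrite !sh.
have shS n : cnt (shift n.+1 u) T.+2 = cnt (shift n (shift 1 u)) T.+2.
  by apply: eq_cnt => s _; rewrite shw.
have b0 : cnt (shift 0 u) T.+2 = cnt (bcons true (shift 1 u)) T.+2.
  by apply: eq_cnt => -[|s] _ //=; rewrite /shift.
case: j {ij uE ujT} uj ec => [|j] uj; first by rewrite u0 in uj.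
case: i {uiT} ui => [|i] ui; rewrite ?b0 !shS => ec.
  by have [_] := ex j T.+2; lia.
have [c1 _] := ex i T.+2; have [_ c2] := ex j T.+2.
by move: c1 c2; rewrite !(cnt_head (bcons _ _)) /=; lia.
Qed.

(** Exchanging a and b replaces each value by its complement to 4, hence reverses the order and the
    pair. *)
Lemma ordered_mismatches_neg (u : nat -> bool) :
  ordered_mismatches 4 u <-> ordered_mismatches 0 (fun t => ~~ u t).
Proof.
have vE n : (right_value 0 (fun t => ~~ u t) n + right_value 4 u n = 4)%N.
  by case: n => i //=; case: (u i).
split=> om i j T ij uE uiT ujT.
  have := om j i T (nesym ij) _ _ uiT.
  have := vE (i%:Z - 1); have := vE (j%:Z - 1).
  suff uE' s : (s < T)%N -> u (j + s)%N = u (i + s)%N.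
    by move=> v1 v2 /(_ uE')/(_ ltac:(by rewrite -[u _]negbK)); lia.
  by move=> /uE/esym/negb_inj.
have := om j i T (nesym ij) _ ujT.
have := vE (i%:Z - 1); have := vE (j%:Z - 1); rewrite negbK => v1 v2 /(_ _ uiT).
suff uE' s : (s < T)%N -> ~~ u (j + s)%N = ~~ u (i + s)%N by move=> /(_ uE'); lia.
by move=> /uE ->.
Qed.

Lemma extremal_neg (u : nat -> bool) : extremal u -> extremal (fun t => ~~ u t).
Proof.
move=> ex i L; have [c1 c2] := ex i L.
have n1 : (cnt (shift i (fun t => ~~ u t)) L + cnt (shift i u) L = L)%N.
  exact: cnt_neg.
have n2 c : (cnt (bcons (~~ c) (fun t => ~~ u t)) L + cnt (bcons c u) L = L)%N.
  by rewrite -[RHS](cnt_neg (bcons c u) L); congr addn; apply: eq_cnt => -[].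
by have /= := n2 true; have /= := n2 false; split; lia.
Qed.

Lemma repeats_neg (u : nat -> bool) : repeats (fun t => ~~ u t) -> repeats u.
Proof.
by move=> [N [q [q0 uE]]]; exists N, q; split=> // t; apply: negb_inj; exact: uE.
Qed.

Lemma repeats_shift (u : nat -> bool) : repeats (shift 1 u) <-> repeats u.
Proof.
split=> -[N [q [q0 uE]]].
  by exists N.+1, q; split=> // t; have := uE t; rewrite /shift !add1n !addSn.
exists N, q; split=> // t; rewrite /shift !add1n -!addnS; exact: uE.
Qed.

Lemma incomparable_right2 (u : nat -> bool) :
  incomparable (right_value 2 u) <-> characteristic_like u.
Proof.
rewrite incomparable_rightP // ordered_mismatches2P /characteristic_like.
by split=> -[].
Qed.

Lemma incomparable_right0 (u : nat -> bool) :
  incomparable (right_value 0 u) <-> u 0%N /\ characteristic_like (shift 1 u).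
Proof.
rewrite incomparable_rightP // /characteristic_like repeats_shift; split.
  by move=> [nr /(ordered_mismatches0P nr)[]].
by move=> [u0 [ex nr]]; split=> //; apply/ordered_mismatches0P.
Qed.

Lemma incomparable_right4 (u : nat -> bool) :
  incomparable (right_value 4 u) <-> ~~ u 0%N /\ characteristic_like (shift 1 u).
Proof.
rewrite incomparable_rightP // ordered_mismatches_neg /characteristic_like.
rewrite repeats_shift; split.
  move=> [nr om]; have nr' : ~ repeats (fun t => ~~ u t) by move/repeats_neg.
  have [u0 ex] := (ordered_mismatches0P nr').1 om; split=> //; split=> //.
  have := extremal_neg ex; congr extremal.
  by apply: funext => t; rewrite /shift negbK.
move=> [u0 [ex nr]]; split=> //.
have nr' : ~ repeats (fun t => ~~ u t) by move/repeats_neg.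
by apply/ordered_mismatches0P => //; split=> //; exact: extremal_neg.
Qed.

Lemma count_mkseq (x : nat -> bool) n : count id (mkseq x n) = cnt x n.
Proof.
elim: n => [|n IH]; first by rewrite cnt0.
by rewrite cntS -IH mkseqS -cats1 count_cat /= addn0.
Qed.

Lemma tail_periodicP (x : nat -> bool) :
  (exists s : seq bool, (0 < size s)%N /\
     forall i, x i = nth false s (i %% size s)) <->
  exists q, (0 < q)%N /\ forall t, x t = x (q + t)%N.
Proof.
split=> [[s [s0 xE]]|[q [q0 xE]]].
  by exists (size s); split=> // t; rewrite !xE modnDl.
exists (mkseq x q); rewrite size_mkseq; split=> // i.
rewrite nth_mkseq ?ltn_mod // {1}(divn_eq i q).
by elim: (i %/ q)%N => [//|k IH]; rewrite mulSn -addnA -xE.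
Qed.

(** * Double-infinite words *)

Definition double_value (u : int -> bool) (n : int) : nat :=
  if u n then 3%N else 1%N.

Lemma block_double u n : block (double_value u) n.
Proof. by rewrite /block /double_value; case: (u n). Qed.

Lemma double_value_inj u i j : double_value u i = double_value u j -> u i = u j.
Proof. by rewrite /double_value; case: (u i); case: (u j). Qed.

Lemma double_value_lt u i j : (double_value u j < double_value u i)%N ->
  u i /\ ~~ u j.
Proof. by rewrite /double_value; case: (u i); case: (u j). Qed.

Section DoubleWords.
Variable u : int -> bool.
Local Notation v := (double_value u).

Definition right_repeats : Prop := exists (N : int) (q : nat), (0 < q)%N /\
  forall t : nat, u (N + t%:Z) = u (N + (q + t)%N%:Z).

Definition left_repeats : Prop := exists (N : int) (q : nat), (0 < q)%N /\
  forall t : nat, u (N - t%:Z) = u (N - (q + t)%N%:Z).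

Lemma aperiodic_doubleP :
  aperiodic (DoubleInf u) <-> ~ right_repeats /\ ~ left_repeats.
Proof.
have rP : right_repeats <-> eventually_right_periodic (DoubleInf u).
  by split=> -[n H]; exists n; exact/(tail_periodicP (fun t => u (n + t%:Z))).
have lP : left_repeats <-> eventually_left_periodic (DoubleInf u).
  split=> -[n].
    move=> /(tail_periodicP (fun t => u (n - t%:Z)))[s [s0 sE]].
    by exists n, (rev s); rewrite size_rev revK.
  move=> [s [s0 sE]]; exists n; apply/(tail_periodicP (fun t => u (n - t%:Z))).
  by exists (rev s); rewrite size_rev.
split=> [[_ nr nl]|[nr nl]]; first by rewrite rP lP.
split; rewrite -?rP -?lP // => -[s [s0 sE]]; apply: nr.
exists 0, (size s); split=> // t; rewrite !sE; congr nth.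
by rewrite !add0r PoszD modzDl.
Qed.

Definition ordered_double_mismatches : Prop := forall (i j : int) (T : nat),
  (forall s : nat, (s < T)%N -> u (i + s%:Z) = u (j + s%:Z)) ->
  u (i + T%:Z) -> ~~ u (j + T%:Z) -> u (i - 1) -> u (j - 1).

(** An excess of two b's between equally long factors is trimmed to b t b against a t a by
    [cnt_excess]. *)
Lemma balanced_doubleP : balanced (DoubleInf u) <-> ordered_double_mismatches.
Proof.
split=> [bal i j T uE uiT ujT ui|om n s t n0 [i ->] [j ->]].
  apply: contrapT => /negP uj.
  have := bal T.+2 _ _ isT (ex_intro _ (i - 1) erefl) (ex_intro _ (j - 1) erefl).
  have Z1 (k : int) (s : nat) : k - 1 + s.+1%:Z = k + s%:Z by lia.
  rewrite !count_mkseq (@excess_cnt _ (fun s => u (j - 1 + s%:Z)) T) ?addr0 ?Z1 //.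
    by lia.
  by move=> s; rewrite !Z1; exact: uE.
rewrite !count_mkseq leqNgt; apply/negP => lt.
have [|l [r [[lr xl yl xr yr] xy]]] :=
  @cnt_excess (fun s => u (i + s%:Z)) (fun s => u (j + s%:Z)) n; first by lia.
have Z2 (k : int) (c : nat) : k + l.+1%:Z + c%:Z = k + (l.+1 + c)%N%:Z by lia.
have Z3 (k : int) : k + l.+1%:Z - 1 = k + l%:Z by lia.
have := om (i + l.+1%:Z) (j + l.+1%:Z) (r - l.+1)%N.
rewrite !Z2 !Z3 subnKC // xl (negPf yl) => H; suff: false by [].
by apply: H => // c cr; rewrite !Z2; apply: xy; lia.
Qed.

Lemma incomparable_double : incomparable v <-> sturmian (DoubleInf u).
Proof.
rewrite /sturmian balanced_doubleP aperiodic_doubleP.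
split=> [W|[om [nr nl]] n m _ _ nm].
  split=> [i j T uE uiT ujT ui|].
    apply: contrapT => /negP uj; have ij : i <> j.
      by move=> ij; move: uj; rewrite -ij ui.
    apply: (W i j); rewrite ?block_double //.
      apply: (@lex_geI _ _ T) => [s /uE|]; rewrite /double_value; first by move->.
      by rewrite uiT (negPf ujT).
    by apply: (@lex_geI _ _ 0) => //; rewrite /double_value !subr0 ui (negPf uj).
  split=> -[N [q [q0 uE]]].
    apply: (@incomparable_no_right_repeat _ N (N + q%:Z) W);
      rewrite ?block_double //.
      by lia.
    by move=> t; rewrite /double_value uE PoszD addrA.
  apply: (@incomparable_no_left_repeat _ (N + 1) (N + 1 - q%:Z) W);
    rewrite ?block_double //; first by lia.
  move=> t; rewrite /double_value addrK uE; congr (if u _ then _ else _).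
  by lia.
move=> /lex_geP[vE|[T vT vE]].
  move=> _; apply: nr; case: (ltgtP n m) nm => // nm _.
    exists n, `|m - n|%N; split=> [|t]; first by lia.
    by apply: double_value_inj; rewrite vE; congr double_value; lia.
  exists m, `|n - m|%N; split=> [|t]; first by lia.
  by apply: double_value_inj; rewrite -vE; congr double_value; lia.
move=> /lex_geP[wE|[t wt wE]].
  apply: nl; case: (ltgtP n m) nm => // nm _.
    exists (m - 1), `|m - n|%N; split=> [|t]; first by lia.
    by apply: double_value_inj; rewrite -wE; congr double_value; lia.
  exists (n - 1), `|n - m|%N; split=> [|t]; first by lia.
  by apply: double_value_inj; rewrite wE; congr double_value; lia.
have [un um] := double_value_lt vT; have [un' um'] := double_value_lt wt.
(* As for right-infinite words, both positions move left by [t] to the left mismatch, and the two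
   agreements join. *)
suff: u (m - t%:Z - 1).
  by have -> : m - t%:Z - 1 = m - 1 - t%:Z by [lia]; rewrite (negPf um').
apply: (om (n - t%:Z) (m - t%:Z) (t + T)%N).
- move=> s st; apply: double_value_inj; case: (ltnP s t) => st'.
    have := wE (t - s.+1)%N ltac:(lia).
    have -> : n - 1 - (t - s.+1)%N%:Z = n - t%:Z + s%:Z by lia.
    by have -> : m - 1 - (t - s.+1)%N%:Z = m - t%:Z + s%:Z by lia.
  have := vE (s - t)%N ltac:(lia).
  have -> : n + (s - t)%N%:Z = n - t%:Z + s%:Z by lia.
  by have -> : m + (s - t)%N%:Z = m - t%:Z + s%:Z by lia.
- by have -> : n - t%:Z + (t + T)%N%:Z = n + T%:Z by lia.
- by have -> : m - t%:Z + (t + T)%N%:Z = m + T%:Z by lia.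
- by have -> : n - t%:Z - 1 = n - 1 - t%:Z by lia.
Qed.

End DoubleWords.

(** * Prefix counts and lines *)

(** A factor of length [L.+1] is compared with a prefix of length [L] preceded by one letter, whose
    two choices give the slack of one. *)
Lemma extremal_cntP (u : nat -> bool) : extremal u <-> forall i L,
  (cnt u i + cnt u L <= cnt u (i + L).+1 <= (cnt u i + cnt u L).+1)%N.
Proof.
have cS i L : (cnt u (i + L).+1 = cnt u i + cnt (shift i u) L.+1)%N.
  by rewrite -addnS; exact: cntD.
have cH c L : cnt (bcons c u) L.+1 = (c + cnt u L)%N by exact: cnt_head.
split=> [ex i L|ex i [|L]]; last 2 first.
- by rewrite !cnt0.
- by have := ex i L; rewrite cS !cH => /andP[]; split; lia.
by have := ex i L.+1; rewrite cS !cH => -[] *; apply/andP; split; lia.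
Qed.

Section Slope.
Variables (R : realType) (m : R) (u : nat -> bool).
Hypotheses (m0 : 0 < m) (mi : irrational m).

Definition cntl (c : bool) (n : nat) : nat := cnt (fun s => u s == c) n.

Lemma cntlS c n : cntl c n.+1 = (cntl c n + (u n == c))%N.
Proof. exact: cntS. Qed.

Lemma cntl_le c i j : (i <= j)%N -> (cntl c i <= cntl c j)%N.
Proof. by move=> /subnKC <-; rewrite /cntl cntD leq_addr. Qed.

Lemma cntl_true n : cntl true n = cnt u n.
Proof. by apply: eq_cnt => s _; case: (u s). Qed.

Lemma cntl_sum n : (cntl false n + cntl true n = n)%N.
Proof.
rewrite cntl_true -[RHS](cnt_neg u n); congr addn.
by apply: eq_cnt => s _; case: (u s).
Qed.

(** The numbers of a's and b's in each prefix are those met by the line. *)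
Definition slope_bounds : Prop := forall n,
  m * (cntl true n)%:R < (cntl false n).+1%:R /\
  (cntl false n)%:R < m * (cntl true n).+1%:R.

Lemma irrational_crossing i j : m * i.+1%:R != j.+1%:R.
Proof.
apply/eqP => mE; apply: mi; exists (j.+1%:R / i.+1%:R) => //.
by rewrite fmorph_div !rmorph_nat -mE mulfK // pnatr_eq0.
Qed.

Lemma before_true i j : before m (true, i) (false, j) = (m * i.+1%:R < j.+1%:R).
Proof.
rewrite /before /abscissa /= ltr_pdivlMr // mulrC andbT.
case: eqP => [/(congr1 (fun x => m * x))|_]; rewrite ?orbF //.
rewrite mulrCA divff ?gt_eqF // mulr1 => /eqP.
by rewrite (negPf (irrational_crossing _ _)).
Qed.

Lemma before_false i j : before m (false, j) (true, i) = (j.+1%:R < m * i.+1%:R).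
Proof. by rewrite /before /abscissa /= andbF orbF ltr_pdivrMr // mulrC. Qed.

Lemma before_same c i j : before m (c, i) (c, j) = (i < j)%N.
Proof.
rewrite /before /abscissa /= andbN andbF orbF.
by case: c; rewrite ?ltr_pM2r ?invr_gt0 // ltr_nat ltnS.
Qed.

Lemma before_asym x y : before m x y -> before m y x -> False.
Proof.
case: x => [[] i]; case: y => [[] j];
  rewrite ?before_same ?before_true ?before_false.
- by move=> ij /(ltn_trans ij); rewrite ltnn.
- by move=> ij /(lt_trans ij); rewrite ltxx.
- by move=> ij /(lt_trans ij); rewrite ltxx.
- by move=> ij /(ltn_trans ij); rewrite ltnn.
Qed.

Section Enumeration.
Variable e : nat -> bool * nat.
Hypotheses (e_surj : forall x, exists i, e i = x).
Hypotheses (e_before : forall i j, (i < j)%N -> before m (e i) (e j)).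
Hypothesis (e_letter : forall i, u i = (e i).1).

Lemma enumeration_lt i j : before m (e i) (e j) -> (i < j)%N.
Proof.
move=> eij; case: (ltngtP i j) => // [/e_before|ij]; first by move/before_asym; case.
by move: eij; rewrite ij => eij; case: (before_asym eij eij).
Qed.

(** Points of one kind are enumerated in order and none is skipped, so the first [n] terms contain
    an initial segment of each kind. *)
Lemma enumeration_prefix n c z :
  (exists2 i, (i < n)%N & e i = (c, z)) <-> (z < cntl c n)%N.
Proof.
elim: n c z => [|n IH] c z.
  by rewrite /cntl cnt0; split=> // -[].
have en : (e n).2 = cntl (u n) n.
  rewrite e_letter; case En: (e n) => [d j] /=; case: (ltngtP j (cntl d n)) => //.
    move=> /IH[i i_n Ei]; have := e_before i_n.
    by rewrite Ei En before_same ltnn.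
  move=> lt; have [i Ei] := e_surj (d, cntl d n).
  have /enumeration_lt i_n : before m (e i) (e n) by rewrite Ei En before_same.
  have /IH : exists2 i, (i < n)%N & e i = (d, cntl d n) by exists i.
  by rewrite ltnn.
have En : e n = (u n, cntl (u n) n) by rewrite -en e_letter; case: (e n).
rewrite cntlS; case: eqP => [<-|uc]; last first.
  rewrite addn0 -IH; split=> -[i i_n Ei]; exists i => //; last exact: ltnW.
  move: i_n; rewrite ltnS leq_eqVlt => /orP[/eqP iE|//].
  by case: uc; move: Ei; rewrite iE En => -[].
rewrite addn1 ltnS leq_eqVlt; split=> [[i + Ei]|/orP[/eqP->|/IH[i i_n Ei]]].
- rewrite ltnS leq_eqVlt => /orP[/eqP iE|i_n].
    by move: Ei; rewrite iE En => -[->]; rewrite eqxx.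
  by apply/orP; right; apply/IH; exists i.
- by exists n.
- by exists i => //; exact: ltnW.
Qed.

Lemma enumerationE n : e n = (u n, cntl (u n) n).
Proof.
rewrite [LHS]surjective_pairing -e_letter; congr pair.
have := (enumeration_prefix n.+1 (u n) (e n).2).1.
have := (enumeration_prefix n (u n) (e n).2).2; rewrite cntlS eqxx addn1 ltnS.
move=> H1 H2; apply/eqP; rewrite eqn_leq H2; last first.
  by exists n => //; rewrite e_letter -surjective_pairing.
rewrite leqNgt; apply/negP => /H1[i i_n Ei]; have := e_before i_n.
by rewrite Ei e_letter -surjective_pairing => H; exact: (before_asym H H).
Qed.

(** The first point of the other kind missing among the first [n] terms has index at least [n], and
    not [n] itself, since [e n] has kind [u n]. *)
Lemma enumeration_next n :
  before m (u n, cntl (u n) n) (~~ u n, cntl (~~ u n) n).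
Proof.
have [i Ei] := e_surj (~~ u n, cntl (~~ u n) n); rewrite -enumerationE -Ei.
apply: e_before; rewrite ltnNge leq_eqVlt; apply/negP => /orP[/eqP iE|i_n].
  by move: Ei; rewrite iE enumerationE => -[]; case: (u n).
have /enumeration_prefix : exists2 i, (i < n)%N & e i = (~~ u n, cntl (~~ u n) n).
  by exists i.
by rewrite ltnn.
Qed.

End Enumeration.

(** Writing a letter raises one count; the bound thereby endangered is [enumeration_next], and the
    other one only improves. *)
Lemma characteristic_slope_bounds : characteristic m u -> slope_bounds.
Proof.
move=> [e [es eb el]] n; elim: n => [|n [IH1 IH2]].
  by rewrite /cntl !cnt0; split; rewrite ?mulr0 ?mulr1 ?ltr01.
have := enumeration_next es eb el n; rewrite !cntlS.
case: (u n) => /=; rewrite ?before_true ?before_false ?addn0 ?addn1 => lt.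
  split=> //; apply: (lt_trans IH2).
  by rewrite ltr_pM2l // ltr_nat.
split=> //; apply: (lt_trans IH1); by rewrite ltr_nat.
Qed.

Lemma slope_bounds_unbounded c z : slope_bounds -> exists n, (z < cntl c n)%N.
Proof.
move=> sb; apply: contrapT => /forallNP nz.
have {}nz n : (cntl c n <= z)%N by rewrite leqNgt; apply/negP/nz.
(* If one count is at most [z], the bounds limit the other by [m * z.+1] or by [z.+1 / m]; [K]
   serves both cases as a bound on the length. *)
pose K : R := z%:R + m * z.+1%:R + z.+1%:R / m.
have K0 : 0 <= K by rewrite /K !addr_ge0 // mulr_ge0 ?invr_ge0 // ltW.
have := archi_boundP K0; set n := Num.bound K => Kn.
have := cntl_sum n => /(congr1 (fun x => x%:R : R)); rewrite natrD => nE.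
have := nz n; rewrite -(ler_nat R) => zn; have [b1 b2] := sb n.
have m1 : 0 < z.+1%:R / m by rewrite divr_gt0.
have m2 : 0 < m * z.+1%:R by rewrite mulr_gt0.
have z0 : 0 <= z%:R :> R by [].
move: Kn; rewrite /K -nE; apply/negP; rewrite -leNgt.
case: c nz zn => nz zn.
  have : m * (cntl true n).+1%:R <= m * z.+1%:R by rewrite ler_pM2l // ler_nat ltnS.
  by lra.
have : (cntl true n)%:R <= z.+1%:R / m.
  rewrite ler_pdivlMr // mulrC; apply: (le_trans (ltW b1)).
  by rewrite ler_nat ltnS.
by lra.
Qed.

Lemma slope_bounds_characteristic : slope_bounds -> characteristic m u.
Proof.
(* Each letter is the point of its kind numbered by its earlier occurrences. *)
move=> sb; exists (fun i => (u i, cntl (u i) i)); split=> // [[c z]|i j ij].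
  case: (ex_minnP (slope_bounds_unbounded c z sb)) => -[|n].
    by rewrite /cntl cnt0.
  move=> zn nmin; exists n.
  have : (cntl c n <= z)%N by rewrite leqNgt; apply/negP => /nmin; rewrite ltnn.
  move: zn; rewrite cntlS; case: eqP => [-> zn nz|_]; last by lia.
  by congr pair; lia.
have := cntl_le (u i) ij; rewrite cntlS eqxx addn1.
have [b1 b2] := sb j.
case: (u i); case: (u j) => le; rewrite ?before_same ?before_true ?before_false //.
  apply: le_lt_trans b1; by rewrite ler_pM2l // ler_nat.
by apply: le_lt_trans b2; rewrite ler_nat.
Qed.

Lemma slope_bounds_extremal : slope_bounds -> extremal u.
Proof.
move=> sb; apply/extremal_cntP => i L.
(* Eliminating the number of a's confines each prefix count to an open interval of length 1. *)
have H n : n%:R - m < (1 + m) * (cnt u n)%:R < n.+1%:R.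
  have := cntl_sum n => /(congr1 (fun x => x%:R : R)).
  have [] := sb n; rewrite natrD cntl_true => b1 b2 nE.
  by apply/andP; split; move: b1 b2; rewrite -!natr1 -nE; lra.
have m1 : 0 < 1 + m by rewrite addr_gt0.
have /andP[h1 h2] := H i; have /andP[h3 h4] := H L.
have /andP[h5 h6] := H (i + L).+1.
move: h2 h4 h5 h6; rewrite -!natr1 natrD => h2 h4 h5 h6.
(* [1 + m] times the defect of additivity lies strictly between [-(1 + m)] and [2 * (1 + m)], so the
   integral defect is 0 or 1. *)
apply/andP; split; rewrite leqNgt; apply/negP; rewrite -(ler_nat R) -(ler_pM2l m1).
  by rewrite -natr1 natrD; lra.
by rewrite -!natr1 natrD; lra.
Qed.

(** Over [k] periods the prefix count grows linearly but stays in a window of fixed width around the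
    line; so the drift [d] per period is 0 and [m] is rational. *)
Lemma slope_bounds_not_repeats : slope_bounds -> ~ repeats u.
Proof.
move=> sb [N [q [q0 uE]]].
pose p := cnt (shift N u) q.
have cE k : cnt u (N + k * q) = (cnt u N + k * p)%N.
  rewrite cntD; congr addn; elim: k => [|k IH]; first by rewrite cnt0.
  rewrite mulSn cntD mulSn -IH; congr addn; apply: eq_cnt => s _.
  by rewrite addnA -uE.
have H n : n%:R - m < (1 + m) * (cnt u n)%:R < n.+1%:R.
  have := cntl_sum n => /(congr1 (fun x => x%:R : R)).
  have [] := sb n; rewrite natrD cntl_true => b1 b2 nE.
  by apply/andP; split; move: b1 b2; rewrite -!natr1 -nE; lra.
pose d : R := (1 + m) * p%:R - q%:R.
have dk k : k%:R * `|d| < 1 + m.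
  rewrite -[k%:R]ger0_norm // -normrM /d ltr_norml.
  have /andP[h1 h2] := H N; have /andP[h3 h4] := H (N + k * q)%N.
  move: h2 h3 h4; rewrite cE -!natr1 !natrD !natrM => h2 h3 h4.
  by apply/andP; split; lra.
have d0 : d = 0.
  apply/eqP; rewrite -normr_eq0; apply/negPn/negP => d0.
  have dp : 0 < `|d| by rewrite lt0r d0 normr_ge0.
  have K0 : 0 <= (1 + m) / `|d| by rewrite divr_ge0 // addr_ge0 // ltW.
  have := archi_boundP K0; rewrite ltr_pdivrMr // => lt.
  by have := lt_trans lt (dk _); rewrite ltxx.
have p0 : p%:R != 0 :> R.
  apply/eqP => p0; move: d0; rewrite /d p0 mulr0 sub0r => /eqP.
  by rewrite oppr_eq0 pnatr_eq0 -leqn0 leqNgt q0.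
apply: mi; exists (q%:R / p%:R - 1) => //.
rewrite rmorphB fmorph_div !rmorph_nat rmorph1; move: d0; rewrite /d => d0.
by have -> : q%:R = (1 + m) * p%:R by [lra]; rewrite mulfK // addrC addKr.
Qed.

End Slope.

(** * Existence of the slope *)

Section SlopeExistence.
Variables (R : realType) (u : nat -> bool).
Hypotheses (ex : extremal u) (nr : ~ repeats u).

(** The count in the prefix of length [n] of a u; the shift by one absorbs the successor in
    [extremal_cntP]. *)
Definition prefix_cnt (n : nat) : nat := cnt u n.-1.
Local Notation Q := prefix_cnt.

Lemma prefix_cntD i j : (Q i + Q j <= Q (i + j) <= (Q i + Q j).+1)%N.
Proof.
case: i => [|i]; first by rewrite /Q cnt0 !add0n leqnn leqnSn.
case: j => [|j]; first by rewrite /Q cnt0 !addn0 leqnn leqnSn.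
by rewrite /Q addnS addSn /=; exact: (extremal_cntP u).1 ex i j.
Qed.

(** [Q] is superadditive and [Q + 1] is subadditive. *)
Lemma prefix_cntM k n : (k * Q n <= Q (k * n) /\
  ((0 < k) -> Q (k * n) + 1 <= k * (Q n).+1))%N.
Proof.
elim: k => [|k [IH1 IH2]] //.
have := prefix_cntD n (k * n); rewrite -mulSn => /andP[h1 h2].
split=> [|_]; first by rewrite mulSn; lia.
case: k IH1 IH2 h1 h2 => [|k] IH1 IH2 h1 h2; first by rewrite !mul1n addn1.
by have := IH2 isT; rewrite [(k.+2 * (Q n).+1)%N]mulSn; lia.
Qed.

Let slopes : set R := [set x | exists2 n, (0 < n)%N & x = (Q n)%:R / n%:R].
Let theta : R := sup slopes.

(** Both fractions are compared through [Q] at the common multiple [n * i]. *)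
Lemma slopes_ub n : (0 < n)%N -> ubound slopes ((Q n).+1%:R / n%:R).
Proof.
move=> n0 _ [i i0 ->]; rewrite ler_pdivrMr ?ltr0n // mulrAC.
rewrite ler_pdivlMr ?ltr0n // -!natrM ler_nat.
have [h1 _] := prefix_cntM n i; have [_ /(_ i0) h2] := prefix_cntM i n.
by move: h1 h2; rewrite [(n * i)%N]mulnC; lia.
Qed.

Lemma slope_prefix n : (0 < n)%N ->
  (Q n)%:R <= n%:R * theta /\ n%:R * theta <= (Q n).+1%:R.
Proof.
move=> n0; have n0R : 0 < n%:R :> R by rewrite ltr0n.
split.
  rewrite mulrC -ler_pdivrMr //; apply: ub_le_sup; last by exists n.
  by exists ((Q 1).+1%:R / 1%:R); exact: slopes_ub.
rewrite mulrC -ler_pdivlMr //.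
by apply: ge_sup; [exists ((Q 1)%:R / 1%:R); exists 1%N|exact: slopes_ub].
Qed.

(** A slope [p / q] confines [Q] so tightly that [Q (n + q) = Q n + p] for positive [n]; then [q] is
    a period of [u]. *)
Lemma rational_slope_repeats q p : (0 < q)%N -> theta = p%:R / q%:R -> False.
Proof.
move=> q0 tE; apply: nr; have q0R : 0 < q%:R :> R by rewrite ltr0n.
have B n : (0 < n)%N -> (q * Q n <= n * p <= q * (Q n).+1)%N.
  move=> n0; have [h1 h2] := slope_prefix n0.
  have pE : n%:R * p%:R = q%:R * (n%:R * theta) :> R.
    by rewrite tE; field; rewrite gt_eqF.
  by rewrite -!(ler_nat R) !natrM pE !ler_pM2l // h1 h2.
have per n : (0 < n)%N -> Q (n + q) = (Q n + p)%N.
  move=> n0; have /andP[d1 d2] := prefix_cntD n q.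
  have /andP[b1 b2] := B _ q0; have /andP[b3 b4] := B _ n0.
  have /andP[b5 b6] := B (n + q)%N ltac:(lia).
  have [m1 m2] := prefix_cntM q n; have [m3 m4] := prefix_cntM n q.
  have {}m2 := m2 q0; have {}m4 := m4 n0.
  rewrite [(n * q)%N]mulnC in m3 m4.
  (* Comparison at [q * n] makes one bound of [B n] strict: [n * p < q * (Q n).+1] in the first
     case, which bounds [Q (n + q)] above through [b5], and [q * Q n < n * p] in the second, which
     bounds it below through [b6]. *)
  have [qp|qp] : p = Q q \/ p = (Q q).+1 by nia.
    by apply/eqP; rewrite eqn_leq; apply/andP; split; [nia|lia].
  by apply/eqP; rewrite eqn_leq; apply/andP; split; [lia|nia].
exists 0%N, q; split=> // t; rewrite !add0n.
have := per t.+1 isT; have := per t.+2 isT; rewrite /Q !addSn /= !cntS.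
by rewrite [(q + t)%N]addnC; case: (u t); case: (u (t + q)%N) => /=; lia.
Qed.

Lemma slope_exists :
  exists m : R, [/\ 0 < m, irrational m & slope_bounds m u].
Proof.
have ti : irrational theta.
  move=> /rationalP[a [b tE]].
  have [t0 _] := slope_prefix (ltn0Sn 0); rewrite mul1r /Q /= cnt0 in t0.
  (* A denominator 0 is possible here and stands for the slope 0. *)
  case: b tE => [|b] tE.
    by apply: (@rational_slope_repeats 1 0) => //; rewrite tE invr0 mulr0 mul0r.
  have a0 : 0 <= a.
    by move: t0; rewrite tE pmulr_lge0 ?invr_gt0 ?ltr0n // ler0z.
  by case: a a0 tE => // a _ tE; apply: (@rational_slope_repeats b.+1 a).
have tn0 p q : (0 < q)%N -> q%:R * theta != p%:R.
  move=> q0; apply/eqP => tE; apply: (@rational_slope_repeats q p) => //.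
  by rewrite -tE mulrC mulKf // pnatr_eq0 -lt0n.
have [t0 t1] := slope_prefix (ltn0Sn 0); rewrite mul1r /Q /= cnt0 in t0 t1.
have {}t0 : 0 < theta.
  by rewrite lt_neqAle t0 andbT eq_sym; have := tn0 0%N 1%N isT; rewrite mul1r.
have {}t1 : theta < 1.
  by rewrite lt_neqAle t1 andbT; have := tn0 1%N 1%N isT; rewrite mul1r.
(* The line meets [m] points of kind a per point of kind b, so the density [theta] of b's is
   [1 / (1 + m)]. *)
exists ((1 - theta) / theta); split.
- by rewrite divr_gt0 // subr_gt0.
- move=> [r _ rE]; apply: ti; exists ((1 + r)^-1) => //.
  rewrite fmorphV rmorphD rmorph1 /= rE.
  have -> : 1 + (1 - theta) / theta = theta^-1 by field; rewrite gt_eqF.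
  by rewrite invrK.
(* With A and B the numbers of a's and b's in the prefix of length [n], the strict bounds at [n.+1]
   read B < (A + B + 1) theta < B + 1, which rearrange to the slope bounds. *)
move=> n; have [b1 b2] := slope_prefix (ltn0Sn n).
have {}b1 : (Q n.+1)%:R < n.+1%:R * theta by rewrite lt_neqAle b1 andbT eq_sym tn0.
have {}b2 : n.+1%:R * theta < (Q n.+1).+1%:R by rewrite lt_neqAle b2 andbT tn0.
have := cntl_sum u n => /(congr1 (fun x => x%:R : R)); rewrite natrD cntl_true => nE.
move: b1 b2; rewrite /Q /= -!natr1 -nE => b1 b2; split.
  by rewrite mulrAC ltr_pdivrMr //; lra.
by rewrite mulrAC ltr_pdivlMr //; lra.
Qed.

End SlopeExistence.

Lemma characteristic_sturmianP (R : realType) (u : nat -> bool) :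
  characteristic_sturmian R u <-> characteristic_like u.
Proof.
split=> [[m [m0 mi]] /(characteristic_slope_bounds m0 mi) sb|[ex nr]].
  split; first exact: slope_bounds_extremal sb.
  exact: slope_bounds_not_repeats sb.
have [m [m0 mi sb]] := slope_exists R ex nr.
by exists m; split=> //; exact: slope_bounds_characteristic.
Qed.

(** * Transport along bijections of positions *)

Section Transport.
Variables (P P' : eqType) (vtx : P -> vertex) (vtx' : P' -> vertex).
Variables (st : arrow -> P -> option P) (st' : arrow -> P' -> option P').
Variables (t : P -> P') (t' : P' -> P).
Hypotheses (tK : cancel t t') (tK' : cancel t' t).
Hypothesis vtxE : forall p, vtx' (t p) = vtx p.
Hypothesis stE : forall g p, st' g (t p) = omap t (st g p).

Lemma transport_all_scalar (k : fieldType) :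
  all_scalar vtx st k -> all_scalar vtx' st' k.
Proof.
move=> sc c' [M1 M2 M3 M4]; have [|l lE] := sc (fun p q => c' (t p) (t q)).
  split.
  - by move=> g p q p' q' gp gq; apply: (M1 g); rewrite stE ?gp ?gq.
  - move=> g p p' q' gp vq gq; apply: (M2 g (t p)); rewrite ?stE ?gp ?vtxE //.
    move=> r; rewrite -[r]tK' stE.
    case gr: (st g (t' r)) => [s|] //= [/(can_inj tK) sq].
    by apply: (gq (t' r)); rewrite gr sq.
  - move=> g p q q' vp gp gq; apply: (M3 g _ _ (t q'));
    by rewrite ?vtxE ?stE ?gp ?gq.
  - by move=> p q vpq; apply: M4; rewrite !vtxE.
exists l => p q; have := lE (t' p) (t' q); rewrite !tK' => ->.
by rewrite (can_eq tK').
Qed.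

Lemma transport_graph_maps_trivial :
  graph_maps_trivial vtx st -> graph_maps_trivial vtx' st'.
Proof.
move=> triv h [hv hs] p q hp.
have /triv/(_ (t' p) (t' q)) : graph_map vtx st (fun r => omap t' (h (t r))).
  split=> [r s|g r vr].
    case hr: (h (t r)) => [x|] //= [<-].
    by rewrite -vtxE tK' (hv _ _ hr) vtxE.
  have := hs g (t r); rewrite vtxE stE => /(_ vr)/(congr1 (omap t')).
  have st'E x : omap t' (st' g x) = st g (t' x).
    by rewrite -{1}[x]tK' stE; case: (st g (t' x)) => //= y; rewrite tK.
  by case: (st g r) => [s|]; case: (h (t r)) => [x|] //=; rewrite st'E.
by rewrite tK' hp => /(_ erefl) /(can_inj tK').
Qed.

End Transport.

(** The two orientations: [true] is for words in a and b, [false] for words in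
    their inverses. *)
Definition arrow_x1 (c : bool) : arrow := if c then alpha1 else alpha2.
Definition arrow_x2 (c : bool) : arrow := if c then alpha2 else alpha1.
Definition arrow_y1 (c : bool) : arrow := if c then beta1 else beta2.
Definition arrow_y2 (c : bool) : arrow := if c then beta2 else beta1.

Definition block_a (c : bool) : seq letter := if c then a else winv a.
Definition block_b (c : bool) : seq letter := if c then b else winv b.

Definition first_letter (c d : bool) : letter :=
  if d then (arrow_y1 c, true) else (arrow_x1 c, false).
Definition second_letter (c d : bool) : letter :=
  if d then (arrow_y2 c, false) else (arrow_x2 c, true).

Definition spelled (c : bool) (u : nat -> bool) (i : nat) : letter :=
  nth (alpha1, true) (if u (i %/ 2)%N then block_b c else block_a c) (i %% 2).

Lemma spelled_even c u n : spelled c u (n * 2) = first_letter c (u n).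
Proof. by rewrite /spelled mulnK // modnMl; case: c; case: (u n). Qed.

Lemma spelled_odd c u n : spelled c u (n * 2).+1 = second_letter c (u n).
Proof.
rewrite /spelled -addn1 divnMDl // addn0 modnMDl.
by case: c; case: (u n).
Qed.

Lemma spelledP c u (f : nat -> letter) :
  (forall n, f (n * 2)%N = first_letter c (u n)) ->
  (forall n, f (n * 2).+1 = second_letter c (u n)) -> f =1 spelled c u.
Proof.
move=> f0 f1 i; rewrite (divn_eq i 2) modn2; case: (odd i).
  by rewrite addn1 f1 spelled_odd.
by rewrite addn0 f0 spelled_even.
Qed.

(** * Strings as spelled binary words *)

Definition may_follow (l m : letter) : bool :=
  [&& ltgt l == lsrc m, m != linv l &
      (l, m) \notin [:: ((alpha1, true), (beta1, true));
                        ((alpha2, true), (beta2, true));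
                        ((beta1, false), (alpha1, false));
                        ((beta2, false), (alpha2, false))]].

Lemma string_may_follow w l m : is_string w -> factor w 2 [:: l; m] ->
  may_follow l m.
Proof.
move=> ws /(string_consecutive ws)[lm ml I]; apply/and3P; split; try exact/eqP.
have [I1 J1] := I alpha1 beta1 isT; have [I2 J2] := I alpha2 beta2 isT.
rewrite !inE; apply/negP => /or4P[] /eqP[l1 m1]; subst l m.
- by case: I1.
- by case: I2.
- by case: J1.
- by case: J2.
Qed.

Lemma may_follow_first c d m : may_follow (first_letter c d) m ->
  m = second_letter c d.
Proof. by case: c; case: d; case: m => -[] []. Qed.

(** Of the letters leaving vertex 2, those of the other orientation are excluded, one by reducedness
    and one by a relation; hence the orientation never changes along a string. *)
Lemma may_follow_second c d m : may_follow (second_letter c d) m ->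
  exists e, m = first_letter c e.
Proof.
by case: c; case: d; case: m => -[] [] // _; (exists true + exists false).
Qed.

Lemma may_precede_first c d l : may_follow l (first_letter c d) ->
  exists e, l = second_letter c e.
Proof.
by case: c; case: d; case: l => -[] [] // _; (exists true + exists false).
Qed.

Lemma may_precede_second c d l : may_follow l (second_letter c d) ->
  l = first_letter c d.
Proof. by case: c; case: d; case: l => -[] []. Qed.

Lemma first_letter_inj c : injective (first_letter c).
Proof. by case: c => -[] []. Qed.

Lemma lsrc_v2 l : lsrc l = v2 -> exists c d, l = first_letter c d.
Proof.
case: l => -[] [] // _.
- by exists true, false.
- by exists false, false.
- by exists true, true.
- by exists false, true.
Qed.

Lemma spelled_from (f : nat -> letter) c d :
  (forall i, may_follow (f i) (f i.+1)) -> f 0%N = first_letter c d ->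
  exists u, f =1 spelled c u.
Proof.
move=> fE f0; exists (fun n => f (n * 2)%N == first_letter c true).
have f1 n : exists e, f (n * 2)%N = first_letter c e.
  elim: n => [|n [e fe]]; first by exists d.
  have := fE (n * 2)%N; rewrite fe => /may_follow_first f1.
  by have := fE (n * 2).+1; rewrite f1 => /may_follow_second.
have f2 n : f (n * 2)%N = first_letter c (f (n * 2)%N == first_letter c true).
  have [e ->] := f1 n; by rewrite (inj_eq (@first_letter_inj c)); case: e.
apply: spelledP => // n; apply: may_follow_first; rewrite -f2; exact: fE.
Qed.

(** The second half of a block a for 0 and of a block b for 4. *)
Definition head_word (c : bool) (h : nat) : seq letter :=
  match h with 0 => [:: (arrow_x2 c, true)] | 4 => [:: (arrow_y2 c, false)]
  | _ => [::] end.

Definition head_value (h : nat) : bool := h \in [:: 0%N; 2; 4].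

(** A letter leaving vertex 1 or 3 is the second half of a block, and one leaving vertex 2 is a
    first half; it also fixes the orientation. *)
Lemma right_string_spelled (f : nat -> letter) : is_string (RightInf f) ->
  exists c h u, [/\ head_value h,
    h = (match lsrc (f 0%N) with v1 => 0 | v2 => 2 | v3 => 4 end)%N
    & f =1 prepend (head_word c h) (spelled c u)].
Proof.
move=> ws; have fE i : may_follow (f i) (f i.+1).
  by apply: (string_may_follow ws); exact: factor2_right.
case v: (lsrc (f 0%N)).
- have [c f0] : exists c, f 0%N = second_letter c false.
    by case: (f 0%N) v => -[] [] // _; [exists false|exists true].
  have := fE 0%N; rewrite f0 => /may_follow_second[d f1].
  have [u uE] := spelled_from (fun i => fE i.+1) f1.
  exists c, 0%N, u; split=> // -[|i]; first by rewrite f0.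
  by rewrite /prepend /= subn1 -uE; case: i.
- have [c [d f0]] := lsrc_v2 v; have [u uE] := spelled_from fE f0.
  by exists c, 2, u; split=> // i; rewrite /prepend /= subn0 nth_nil uE.
- have [c f0] : exists c, f 0%N = second_letter c true.
    by case: (f 0%N) v => -[] [] // _; [exists false|exists true].
  have := fE 0%N; rewrite f0 => /may_follow_second[d f1].
  have [u uE] := spelled_from (fun i => fE i.+1) f1.
  exists c, 4, u; split=> // -[|i]; first by rewrite f0.
  by rewrite /prepend /= subn1 -uE; case: i.
Qed.

Lemma head_valueP h : head_value h -> [\/ h = 0%N, h = 2%N | h = 4%N].
Proof.
rewrite /head_value !inE => /or3P[] /eqP ->;
  by [constructor 1|constructor 2|constructor 3].
Qed.

(** * Block models of strings *)

Section RightModel.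
Variables (c : bool) (h : nat) (u : nat -> bool) (f : nat -> letter).
Hypotheses (ws : is_string (RightInf f)) (hh : head_value h).
Hypothesis fE : f =1 prepend (head_word c h) (spelled c u).
Local Notation v := (right_value h u).
Let o := size (head_word c h).

Let oE : o = (h != 2) :> nat.
Proof. by rewrite /o; case: (head_valueP hh) => ->. Qed.

Let f_first i : f (i * 2 + o)%N = first_letter c (u i).
Proof.
by rewrite fE /prepend nth_default ?leq_addl // addnK spelled_even.
Qed.

Let f_second i : f (i * 2 + o).+1 = second_letter c (u i).
Proof.
rewrite fE /prepend nth_default ?leqW ?leq_addl //.
by rewrite -addSn addnK spelled_odd.
Qed.

Let f_head : h != 2%N -> f 0%N = second_letter c (h == 4%N).
Proof.
by rewrite fE; case: (head_valueP hh) => ->; case: c.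
Qed.

(** The offset [o] is 1 exactly when a half block precedes the first node; its middle is then
    position 0, with index -1. *)
Definition right_node (n : int) : nat := (`|n| * 2 + o)%N.
Definition right_middle (n : int) : nat :=
  if n is Posz i then (i * 2 + o).+1 else 0%N.
Definition right_locate (p : nat) : int * bool :=
  if (p < o)%N then (-1, true) else (((p - o) %/ 2)%N%:Z, odd (p - o)).

Let hblock n : block v n = (0 <= n).
Proof.
by apply: block_right; case: (head_valueP hh) => ->.
Qed.

Let letters : [/\ forall d, first_letter c d != (arrow_x1 c, true),
  forall d, second_letter c d != (arrow_x1 c, true),
  forall d, first_letter c d != (arrow_x2 c, true),
  forall d, first_letter c d != (arrow_y2 c, true) &
  forall d, second_letter c d != (arrow_y1 c, true)].
Proof. by split=> -[]; case: c. Qed.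

Lemma right_block_model :
  block_model (@vertex_at (RightInf f)) (@step (RightInf f))
    (arrow_x1 c) (arrow_x2 c) (arrow_y1 c) (arrow_y2 c) v.
Proof.
have ncase n : block v (n + 1) -> (exists i, n = Posz i) \/ n = -1.
  by rewrite hblock; case: n => [i _|[|i]]; [left; exists i|right|].
have h2 : v (-1) != 2%N -> h != 2%N /\ (h == 4%N) = (3 <= v (-1))%N.
  by case: (head_valueP hh) => ->.
apply: (@BlockModel _ _ _ _ _ _ _ _ right_node right_middle right_locate).
- by case: c; [left|right].
- by move=> g p q; exact: (vertex_at_step_src ws).
- by rewrite hblock.
- by move=> n; rewrite !hblock; lia.
- by move=> n m; rewrite !hblock; lia.
- move=> [i|i] /=; first by case: (u i).
  by case: (head_valueP hh) => ->.
- move=> p; rewrite /right_locate; case: ltnP => op.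
    rewrite hblock; move: op; rewrite oE; case: eqP => // /eqP h2' p0.
    by split=> //; case: p p0.
  rewrite !hblock; case: ifP => podd; split=> //=; first by case: (u _).
    by have := divn_eq (p - o) 2; rewrite modn2 podd; lia.
  by rewrite /right_node; have := divn_eq (p - o) 2; rewrite modn2 podd; lia.
- move=> n; rewrite hblock; case: n => // i _.
  rewrite /right_locate /right_node /= ltnNge leq_addl /= addnK mulnK //.
  by rewrite oddM andbF.
- move=> n /ncase[[i ->] _|->].
    rewrite /right_locate /= ltnNge leqW ?leq_addl //= -addSn addnK.
    by rewrite -addn1 divnMDl // addn0 oddD oddM andbF.
  by move=> /h2[h2' _]; rewrite /right_locate /= oE h2'.
- move=> n; rewrite hblock; case: n => // i _ /=.
  by rewrite /right_node /= f_first; case: c; case: (u i).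
- move=> n /ncase[[i ->] _|-> /h2[h2' hE]] /=.
    by rewrite f_second; case: c; case: (u i).
  by rewrite f_head //; case: (head_valueP hh) h2' => -> // _; case: c.
- have [_ L2 _ _ _] := letters; move=> n /ncase[[i ->]|->] /=.
    rewrite f_second (negPf (L2 _)); case ui: (u i) => //= _.
    by rewrite f_first ui /first_letter eqxx.
  move=> h1; rewrite f_head; last by apply: contraTneq h1 => ->.
  by rewrite (negPf (L2 _)); case: (head_valueP hh) h1 => ->.
- move=> n /ncase[[i ->]|->] /=.
    rewrite f_second; case ui: (u i) => //= _; rewrite eqxx /right_node.
    by congr Some; lia.
  move=> h1; rewrite f_head; last by apply: contraTneq h1 => ->.
  by rewrite /right_node /= oE; case: (head_valueP hh) h1 => -> //= _; rewrite eqxx.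
- have [_ _ _ _ L5] := letters.
  move=> n; rewrite hblock; case: n => // i _; rewrite /right_node /= f_first.
  case ui: (u i); first by rewrite /first_letter eqxx.
  have -> : first_letter c false == (arrow_y1 c, true) = false by case: c.
  case E : (i * 2 + o)%N => [//|p]; case: eqP => // fp.
  have [[j jE]|[p0 o1]] : (exists j, p = (j * 2 + o).+1) \/ p = 0%N /\ o = 1%N.
    case: i E {ui} => [|i] E; last by left; exists i; lia.
    by right; move: E; rewrite oE; case: (h != 2%N) => //=; lia.
  - by move: fp; rewrite jE f_second; case: c; case: (u j).
  - move: fp; rewrite p0 f_head; first by case: c; case: (h == 4%N).
    by move: o1; rewrite oE; case: (h != 2%N).
- have [_ _ _ L4 _] := letters.
  move=> n /ncase[[i ->]|->].
    have -> : right_node (i%:Z + 1) = (i * 2 + o).+2.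
      by rewrite /right_node; lia.
    rewrite /= -[(i * 2 + o).+2]/((i.+1 * 2) + o)%N f_first (negPf (L4 _)) f_second.
    by case: (u i); case: c.
  rewrite /right_node /= mul0n add0n.
  have -> : f o == (arrow_y2 c, true) = false.
    by rewrite -[o]/(0 * 2 + o)%N f_first (negPf (L4 _)).
  case: (head_valueP hh) => hE; rewrite oE hE //= f_head ?hE //=.
  all: by case: c.
Qed.

End RightModel.
Section DoubleModel.
Variables (c : bool) (o : int) (u : int -> bool) (f : int -> letter).
Hypothesis ws : is_string (DoubleInf f).
Hypothesis f_first : forall n, f (n * 2 + o) = first_letter c (u n).
Hypothesis f_second : forall n, f (n * 2 + o + 1) = second_letter c (u n).

Lemma double_block_model :
  block_model (@vertex_at (DoubleInf f)) (@step (DoubleInf f))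
    (arrow_x1 c) (arrow_x2 c) (arrow_y1 c) (arrow_y2 c) (double_value u).
Proof.
have bl := block_double u; have vP n : double_value u n = if u n then 3%N else 1%N.
  by [].
have prev n : f (n * 2 + o - 1) = second_letter c (u (n - 1)).
  by rewrite -f_second; congr f; lia.
apply: (@BlockModel _ _ _ _ _ _ _ _ (fun n => n * 2 + o) (fun n => n * 2 + o + 1)
  (fun p => (((p - o) %/ 2)%Z, ((p - o) %% 2)%Z == 1))).
- by case: c; [left|right].
- by move=> g p q; exact: (vertex_at_step_src ws).
- exact: bl.
- by move=> n _; exact: bl.
- by move=> n m _ _; rewrite bl.
- by move=> n; rewrite vP; case: (u n).
- move=> p; case: eqP => p1; split; rewrite ?bl ?vP //; first by case: (u _).
    lia.
  lia.
- by move=> n _; congr pair; [lia|apply/eqP; lia].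
- by move=> n _ _; congr pair; [lia|apply/eqP; lia].
- by move=> n _ /=; rewrite f_first; case: c; case: (u n).
- by move=> n _ _ /=; rewrite f_second vP; case: c; case: (u n).
- move=> n _; rewrite vP; case un: (u n) => //= _.
  by rewrite f_second addrK f_first un; case: c.
- move=> n _; rewrite vP; case un: (u n) => //= _; rewrite f_second un.
  by rewrite eqxx; congr Some; lia.
- move=> n _; rewrite vP /= f_first prev; case: (u n); first by case: c.
  by case: (u (n - 1)); case: c.
- move=> n _; rewrite vP /= f_first prev addrK.
  have -> : (n + 1) * 2 + o - 1 = n * 2 + o + 1 by lia.
  by case: (u (n + 1)); case: (u n); case: c.
Qed.

End DoubleModel.

Definition double_spelled (c : bool) (u : int -> bool) (i : int) : letter :=
  nth (alpha1, true) (if u (i %/ 2)%Z then block_b c else block_a c)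
    `|(i %% 2)%Z|%N.

Lemma double_spelledP c u (f : int -> letter) o :
  (forall i, f i = double_spelled c u (i - o)) <->
  (forall n, f (n * 2 + o) = first_letter c (u n)) /\
  (forall n, f (n * 2 + o + 1) = second_letter c (u n)).
Proof.
have e0 n : double_spelled c u (n * 2) = first_letter c (u n).
  rewrite /double_spelled; have -> : (n * 2 %/ 2)%Z = n by lia.
  have -> : `|(n * 2 %% 2)%Z|%N = 0%N by lia.
  by case: c; case: (u n).
have e1 n : double_spelled c u (n * 2 + 1) = second_letter c (u n).
  rewrite /double_spelled; have -> : ((n * 2 + 1) %/ 2)%Z = n by lia.
  have -> : `|((n * 2 + 1) %% 2)%Z|%N = 1%N by lia.
  by case: (c); case: (u n).
split=> [fE|[f0 f1] i].
  by split=> n; rewrite fE; [rewrite addrK|rewrite addrAC addrK].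
have /orP[/eqP i0|/eqP i1] :
    (((i - o) %% 2)%Z == 0) || (((i - o) %% 2)%Z == 1) by lia.
  have iE : i - o = ((i - o) %/ 2)%Z * 2 by lia.
  by rewrite iE e0 -f0 -iE subrK.
have iE : i - o = ((i - o) %/ 2)%Z * 2 + 1 by lia.
by rewrite iE e1 -f1 addrAC -iE subrK.
Qed.

Lemma double_string_spelled (f : int -> letter) : is_string (DoubleInf f) ->
  exists c u o, forall i, f i = double_spelled c u (i - o).
Proof.
move=> ws; have fE i : may_follow (f i) (f (i + 1)).
  by apply: (string_may_follow ws); exact: factor2_double.
(* Every letter has one end at vertex 2, so position 0 or 1 will do. *)
have [o vo] : exists o, lsrc (f o) = v2.
  case v: (lsrc (f 0)); [exists 1|by exists 0|exists 1];
  by have := fE 0; rewrite add0r; case: (f 0) v => -[] [] //; case: (f 1) => -[] [].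
have [c [d fo]] := lsrc_v2 vo.
exists c, (fun n => f (n * 2 + o) == first_letter c true), o.
have f1 n : exists e, f (n * 2 + o) = first_letter c e.
  elim: n => [|n [e fe]|n [e fe]]; first by exists d; rewrite mul0r add0r.
    have := fE (n%:Z * 2 + o); rewrite fe => /may_follow_first f1.
    have := fE (n%:Z * 2 + o + 1); rewrite f1.
    have -> : n.+1%:Z * 2 + o = n%:Z * 2 + o + 1 + 1 by lia.
    exact: may_follow_second.
  have := fE (- n%:Z * 2 + o - 1); rewrite subrK fe.
  move=> /may_precede_first[e' f1].
  have := fE (- n%:Z * 2 + o - 1 - 1); rewrite subrK f1 => /may_precede_second f2.
  exists e'; rewrite -f2; congr f; lia.
have f2 n : f (n * 2 + o) = first_letter c (f (n * 2 + o) == first_letter c true).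
  have [e ->] := f1 n; by rewrite (inj_eq (@first_letter_inj c)); case: e.
apply/double_spelledP; split=> // n; apply: may_follow_first; rewrite -f2; exact: fE.
Qed.

(** * Inverse words *)

Definition positions_isomorphic (w w' : infword letter) : Prop :=
  exists (t : pos w -> pos w') (t' : pos w' -> pos w), [/\ cancel t t', cancel t' t,
    forall p, vertex_at (t p) = vertex_at p
    & forall g p, step g (t p) = omap t (step g p)].

Lemma positions_isomorphic_sym w w' :
  positions_isomorphic w w' -> positions_isomorphic w' w.
Proof.
move=> [t [t' [tK tK' vE sE]]]; exists t', t; split=> // [p|g p].
  by rewrite -vE tK'.
by rewrite -{2}[p]tK' sE; case: (step g (t' p)) => //= q; rewrite tK.
Qed.

Lemma eq_linv l g d : (linv l == (g, d)) = (l == (g, ~~ d)).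
Proof. by rewrite -(can_eq linvK) linvK. Qed.

(** One-sided words keep their positions, since letter [i] joins [i] and [i + 1] in both
    conventions. *)
Lemma positions_isomorphic_inv w : is_string w ->
  positions_isomorphic w (word_inv w).
Proof.
case: w => f ws.
- exists id, id; split=> // [p|g p] /=; first by rewrite ltgt_inv.
  by rewrite !eq_linv; case: p => [|p] /=; rewrite ?eq_linv; do ![case: ifP => //].
- exists id, id; split=> // [p|g p] /=; first by rewrite lsrc_inv.
  by rewrite !eq_linv; case: p => [|p] /=; rewrite ?eq_linv; do ![case: ifP => //].
(* Letter [i], between [i] and [i + 1], becomes letter [-i], between [-i] and [1 - i]; positions are
   reflected accordingly. *)
exists (fun p => 1 - p), (fun p => 1 - p); split=> [p|p|p|g p] /=; try by lia.
  rewrite lsrc_inv opprB.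
  by have := string_consecutive ws (factor2_double f (p - 1)); rewrite subrK => -[].
rewrite !eq_linv /= opprB.
have -> : - (1 - p - 1) = p by lia.
have := string_consecutive ws (factor2_double f (p - 1)); rewrite subrK => -[_ fp _].
case: (eqVneq (f (p - 1)) (g, false)) fp => [->|_] fp; last first.
  by case: eqP => //= _; congr Some; lia.
by case: eqP => [/fp//|_] /=; congr Some; lia.
Qed.

Section Bricks.
Variable k : closedFieldType.

Lemma block_model_brick w (ws : is_string w) x1 x2 y1 y2 v :
  block_model (@vertex_at w) (@step w) x1 x2 y1 y2 v ->
  brick (string_module k ws) <-> incomparable v.
Proof.
move=> B; split=> [/brick_graph_maps_trivial|W].
  exact: graph_maps_trivial_incomparable B.
apply: brick_all_scalar; last exact: (incomparable_all_scalar B).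
by exists (node B 0).
Qed.

Lemma string_all_scalar w : is_string w -> ~~ left_infinite w ->
  graph_maps_trivial (@vertex_at w) (@step w) ->
  all_scalar (@vertex_at w) (@step w) k.
Proof.
case: w => // f ws _ triv.
  have [c [h [u [hh _ fE]]]] := right_string_spelled ws.
  have B := right_block_model ws hh fE.
  exact: incomparable_all_scalar B _ (graph_maps_trivial_incomparable B triv).
have [c [u [o /double_spelledP[f0 f1]]]] := double_string_spelled ws.
have B := double_block_model ws f0 f1.
exact: incomparable_all_scalar B _ (graph_maps_trivial_incomparable B triv).
Qed.

(** Trivial graph maps yield scalar matrices through a block model, hence for words that are not
    left-infinite. The transport comes after this step if [w] is such a word, and before it
    otherwise. *)
Lemma isomorphic_brick w (ws : is_string w) w' (ws' : is_string w') :
  positions_isomorphic w w' -> ~~ (left_infinite w && left_infinite w') ->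
  brick (string_module k ws) -> brick (string_module k ws').
Proof.
move=> [t [t' [tK tK' vE sE]]] lr br; have [[[i [x _]] _] triv] :=
  (br, brick_graph_maps_trivial br).
apply: brick_all_scalar; first by case: (w') => f; exists 0.
move: lr; rewrite negb_and => /orP[wr|wr'].
  by apply: (transport_all_scalar tK tK' vE sE); exact: string_all_scalar.
apply: string_all_scalar => //.
exact: (transport_graph_maps_trivial tK tK' vE sE).
Qed.

Lemma inverse_brick w (ws : is_string w) :
  brick (string_module k ws) <-> brick (string_module k (is_string_word_inv ws)).
Proof.
have iso := positions_isomorphic_inv ws.
split; apply: isomorphic_brick => //; try exact: positions_isomorphic_sym.
- by case: (w).
- by case: (w).
Qed.

Lemma right_brick f (ws : is_string (RightInf f)) c h u : head_value h ->
  f =1 prepend (head_word c h) (spelled c u) ->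
  brick (string_module k ws) <-> incomparable (right_value h u).
Proof. by move=> hh fE; apply: block_model_brick (right_block_model ws hh fE). Qed.

Lemma double_brick f (ws : is_string (DoubleInf f)) c u o :
  (forall i, f i = double_spelled c u (i - o)) ->
  brick (string_module k ws) <-> sturmian (DoubleInf u).
Proof.
move=> /double_spelledP[f0 f1]; rewrite -incomparable_double.
exact: block_model_brick (double_block_model ws f0 f1).
Qed.

Lemma linv_second_letter c d : linv (second_letter c d) = first_letter (~~ c) d.
Proof. by case: c; case: d. Qed.

Lemma linv_first_letter c d : linv (first_letter c d) = second_letter (~~ c) d.
Proof. by case: c; case: d. Qed.

Lemma double_brickP f (ws : is_string (DoubleInf f)) :
  brick (string_module k ws) <->
  sturmian_in a b (DoubleInf f) \/ sturmian_in a b (word_inv (DoubleInf f)).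
Proof.
have str g (gs : is_string (DoubleInf g)) :
    sturmian_in a b (DoubleInf g) -> brick (string_module k gs).
  move=> [[f0|f0|u] [[_ //= [o gE]] ust]].
  by apply/(@double_brick _ _ true u (- o)) => // i; rewrite opprK gE.
split=> [br|[/str|/str br]]; last 2 first.
- exact.
- by apply/inverse_brick; exact: br.
have [c [u [o fE]]] := double_string_spelled ws.
case: c fE => fE; [left|right].
  exists (DoubleInf u); split; last exact/(double_brick ws fE).
  by split=> //; exists (- o) => i; rewrite fE.
have [f0 f1] := (double_spelledP _ _ _ _).1 fE.
(* The second half of block [n], at [n * 2 + o + 1], becomes the first half of block [-n]; this
   gives the offset [- o - 1]. *)
have gE i : linv (f (- i)) = double_spelled true (fun n => u (- n)) (i - (- o - 1)).
  move: i; apply/double_spelledP; split=> n.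
    by rewrite -[RHS](linv_second_letter false) -f1; congr (linv (f _)); lia.
  by rewrite -[RHS](linv_first_letter false) -f0; congr (linv (f _)); lia.
exists (DoubleInf (fun n => u (- n))); split.
  split; first exact: is_string_word_inv ws.
  by exists (- (- o - 1)) => i; rewrite gE.
apply/(double_brick (is_string_word_inv ws) gE); exact: (inverse_brick ws).1 br.
Qed.

End Bricks.

(** * Right-infinite bricks by start vertex *)

Lemma is_string_drop (f : nat -> letter) n :
  is_string (RightInf f) -> is_string (RightInf (fun i => f (n + i)%N)).
Proof.
move=> ws N s [i ->]; apply: (ws N); exists (n + i)%N.
by apply: eq_map => j; rewrite addnA.
Qed.

Definition first_block (c : bool) (h : nat) : seq letter :=
  if h == 0%N then block_b c else block_a c.

Lemma spelled_bcons c d u i : spelled c (bcons d u) i =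
  prepend (if d then block_b c else block_a c) (spelled c u) i.
Proof.
have sz : size (if d then block_b c else block_a c) = 2 by case: c; case: d.
case: i => [|[|i]]; first by case: (c); case: (d).
  by case: (c); case: (d).
rewrite /prepend nth_default sz // subSS subSS subn0 /spelled.
have -> : (i.+2 %/ 2 = (i %/ 2).+1)%N by lia.
by have -> : (i.+2 %% 2 = i %% 2)%N by lia.
Qed.

Lemma prepend_cat (T : Type) (s t : seq T) g : prepend (s ++ t) g =1
  prepend s (prepend t g).
Proof.
move=> i; rewrite /prepend nth_cat size_cat; case: ltnP => si.
  by apply: set_nth_default.
by rewrite subnDA [RHS]nth_default.
Qed.

Lemma eq_prepend (T : Type) (s : seq T) f g : f =1 g -> prepend s f =1 prepend s g.
Proof. by move=> fg i; rewrite /prepend fg. Qed.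

Section RightBricks.
Variables (R : realType) (k : closedFieldType) (f : nat -> letter).
Hypothesis ws : is_string (RightInf f).

(** Made to unfold to one alternative of the theorem: [h] is 0 or 4 for start vertex 1 or 3, and [c]
    is the orientation. *)
Definition headed (c : bool) (h : nat) : Prop := exists w' : nat -> letter,
  same_word (RightInf f)
    (RightInf (prepend (head_word c h ++ first_block c h) w')) /\
  characteristic_sturmian_in R (block_a c) (block_b c) (RightInf w').

Lemma headed_brick c h : h = 0%N \/ h = 4%N -> headed c h ->
  brick (string_module k ws).
Proof.
move=> hh [w' [fE [u [[_ wE] /characteristic_sturmianP cu]]]].
have {}fE : f =1 prepend (head_word c h) (spelled c (bcons (h == 0%N) u)).
  move=> i; rewrite fE prepend_cat; apply: eq_prepend => {}i.
  by rewrite spelled_bcons; apply: eq_prepend => {}i; rewrite wE.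
have hv : head_value h by case: hh => ->.
apply/(right_brick _ _ hv fE).
by case: hh => ->; [apply/incomparable_right0|apply/incomparable_right4].
Qed.

Lemma brick_headed c h u : h = 0%N \/ h = 4%N ->
  f =1 prepend (head_word c h) (spelled c u) ->
  brick (string_module k ws) -> headed c h.
Proof.
move=> hh fE; have hv : head_value h by case: hh => ->.
move=> /(right_brick _ _ hv fE) W.
have [u0 cu] : u 0%N = (h == 0%N) /\ characteristic_like (shift 1 u).
  case: hh W => -> W; first by have [] := (incomparable_right0 u).1 W.
  by have [/negPf ->] := (incomparable_right4 u).1 W.
have uE : u =1 bcons (h == 0%N) (shift 1 u) by case.
have fE3 : f =1 prepend (head_word c h ++ first_block c h) (spelled c (shift 1 u)).
  move=> i; rewrite fE prepend_cat; apply: eq_prepend => {}i.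
  by rewrite -spelled_bcons /spelled uE.
exists (spelled c (shift 1 u)); split=> //; exists (shift 1 u); split; last first.
  exact/characteristic_sturmianP.
(* [Str] asks that the tail be a string itself; it is what remains of [f] after the 3 letters of the
   half block and the first block. *)
split=> //; have -> : spelled c (shift 1 u) = fun i => f (3 + i)%N.
  apply: funext => i; rewrite fE3 /prepend.
  have -> : size (head_word c h ++ first_block c h) = 3.
    by case: hh => ->; case: (c).
  rewrite nth_default ?addKn //; case: hh => ->; case: (c) => //.
exact: is_string_drop.
Qed.

Lemma unheaded_brick c :
  characteristic_sturmian_in R (block_a c) (block_b c) (RightInf f) ->
  brick (string_module k ws).
Proof.
move=> [u [[_ fE] /characteristic_sturmianP cu]].
have {}fE : f =1 prepend (head_word c 2) (spelled c u).
  by move=> i; rewrite fE /prepend /= subn0 nth_nil.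
by apply/(right_brick k ws (c := c) (h := 2) isT fE)/incomparable_right2.
Qed.

Lemma brick_unheaded c u : f =1 spelled c u -> brick (string_module k ws) ->
  characteristic_sturmian_in R (block_a c) (block_b c) (RightInf f).
Proof.
move=> fE br; exists u; split=> //; apply/characteristic_sturmianP.
apply/incomparable_right2; apply/(right_brick k ws (c := c) (h := 2)) => //.
by move=> i; rewrite fE /prepend /= subn0 nth_nil.
Qed.

Lemma brick_v1 : lsrc (f 0%N) = v1 ->
  brick (string_module k ws) <-> headed true 0 \/ headed false 0.
Proof.
move=> f0; split=> [br|]; last by case; apply: headed_brick; left.
have [c [h [u [_ hE fE]]]] := right_string_spelled ws; rewrite f0 in hE.
by subst h; case: c fE => fE; [left|right]; apply: (brick_headed _ fE) => //; left.
Qed.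

Lemma brick_v2 : lsrc (f 0%N) = v2 -> brick (string_module k ws) <->
  characteristic_sturmian_in R (block_a true) (block_b true) (RightInf f) \/
  characteristic_sturmian_in R (block_a false) (block_b false) (RightInf f).
Proof.
move=> f0; split=> [br|[]]; try exact: unheaded_brick.
have [c [h [u [_ hE fE]]]] := right_string_spelled ws; rewrite f0 in hE; subst h.
have {}fE : f =1 spelled c u by move=> i; rewrite fE /prepend /= subn0 nth_nil.
by case: c fE => fE; [left|right]; exact: brick_unheaded br.
Qed.

Lemma brick_v3 : lsrc (f 0%N) = v3 ->
  brick (string_module k ws) <-> headed true 4 \/ headed false 4.
Proof.
move=> f0; split=> [br|]; last by case; apply: headed_brick; right.
have [c [h [u [_ hE fE]]]] := right_string_spelled ws; rewrite f0 in hE.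
by subst h; case: c fE => fE; [left|right]; apply: (brick_headed _ fE) => //; right.
Qed.

End RightBricks.

Theorem theorem4p10 (R : realType) (k : closedFieldType) (w : infword letter)
    (ws : is_string w) :
  (* (1) *)
  (starts_at w v1 ->
    (brick (string_module k ws) <->
      (exists w' : nat -> letter,
         same_word w (RightInf (prepend ([:: (alpha2, true)] ++ b) w')) /\
         characteristic_sturmian_in R a b (RightInf w')) \/
      (exists w' : nat -> letter,
         same_word w (RightInf (prepend ([:: (alpha1, true)] ++ winv b) w')) /\
         characteristic_sturmian_in R (winv a) (winv b) (RightInf w')))) /\
  (* (2) *)
  (starts_at w v2 ->
    (brick (string_module k ws) <->
      characteristic_sturmian_in R a b w \/
      characteristic_sturmian_in R (winv a) (winv b) w)) /\
  (* (3) *)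
  (starts_at w v3 ->
    (brick (string_module k ws) <->
      (exists w' : nat -> letter,
         same_word w (RightInf (prepend ([:: (beta2, false)] ++ a) w')) /\
         characteristic_sturmian_in R a b (RightInf w')) \/
      (exists w' : nat -> letter,
         same_word w (RightInf (prepend ([:: (beta1, false)] ++ winv a) w')) /\
         characteristic_sturmian_in R (winv a) (winv b) (RightInf w')))) /\
  (* (4) *)
  (left_infinite w ->
    (brick (string_module k ws) <-> brick (string_module k (is_string_word_inv ws)))) /\
  (* (5) *)
  (double_infinite w ->
    (brick (string_module k ws) <->
      sturmian_in a b w \/ sturmian_in a b (word_inv w))).
Proof.
split; first by case: w ws => // f fs f0; exact: brick_v1.
split; first by case: w ws => // f fs f0; exact: brick_v2.
split; first by case: w ws => // f fs f0; exact: brick_v3.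
split; first by move=> _; exact: inverse_brick.
by case: w ws => // f fs _; exact: double_brickP.
Qed.
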